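(* Let $h>0$ and let $p$ and $q$ be relatively prime positive integers such that $1<\frac pq<\frac{\sqrt{h^2+1}}{h}$. Then there exists a unique (up to rotation) closed immersed curve $X$ in the plane, with rotation number $p$ and $q$-fold rotational symmetry, such that it generates a helicoidal surface with pitch $h$ and constant mean curvature $H=1$ with respect to the outward pointing unit normal. Moreover, with $$\alpha_h=\frac{\sqrt{h^2+4}}{h\pi}E\!\left(\frac{2}{\sqrt{h^2+4}}\right)+\frac12,$$ the following hold: - if $\frac pq=\alpha_h$, then $X$ goes through the origin; - if $\frac pq>\alpha_h$, then $X$ has winding number $p$ around the origin; - if $\frac pq<\alpha_h$, then $X$ has winding number $p-q$ around the origin.
   Context: $E(k)=\int_0^{\pi/2}\sqrt{1-k^2\sin^2\theta}\,d\theta$ is the complete elliptic integral of the second kind. Identify $\mathbf R^2$ with $\mathbf C$. For $h>0$ and an immersed curve $X$ in $\mathbf R^2$ parametrized by arc length $s$, the helicoidal surface of pitch $h$ generated by $X$ is the immersed surface $F(s,t)=(e^{it}X(s),ht)$ in $\mathbf R^3$. Put $T=\frac{dX}{ds}$, $N=iT$, $\tau=\langle X,T\rangle$. The mean curvature with respect to a unit normal field $\mathbf m$ is $\operatorname{div}\mathbf m$ (divergence along the surface; so a round cylinder of radius $1$ has mean curvature $1$ with respect to its outward normal). The closed curve $X$ is oriented so that its rotation number (total variation of the tangent angle divided by $2\pi$) is positive; then $\mathbf n=\frac{(he^{it}N,-\tau)}{\sqrt{\tau^2+h^2}}$ is the inward pointing unit normal and $-\mathbf n$ is the outward pointing one.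 Closed curves are traversed once (not multiply covered). ''$q$-fold rotational symmetry'' means that the group of rotations about the origin preserving $X$ is cyclic of order $q$. ''Up to rotation'' means up to rotation of the plane about the origin (and reparametrization). *)

(* Defs.v *)
From Stdlib Require Import Reals ZArith.
From Coquelicot Require Import Coquelicot.

Open Scope R_scope.

Definition ellipticE (k : R) : R :=
  RInt (fun theta => sqrt (1 - k ^ 2 * sin theta ^ 2)) 0 (PI / 2).

Definition alpha (h : R) : R :=
  sqrt (h ^ 2 + 4) / (h * PI) * ellipticE (2 / sqrt (h ^ 2 + 4)) + 1 / 2.

(** * The plane, identified with [C] *)

Definition cis (t : R) : C := (cos t, sin t).

Definition dotC (z w : C) : R := Re z * Re w + Im z * Im w.

(** Derivative of a plane curve [R -> C]; Coquelicot's [C_derive] is for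
    functions of a complex variable. *)
Definition CDerive (X : R -> C) (s : R) : C :=
  (Derive (fun u => Re (X u)) s, Derive (fun u => Im (X u)) s).

Definition smooth_curve (X : R -> C) : Prop :=
  forall (n : nat) (s : R),
    ex_derive_n (fun u => Re (X u)) n s /\ ex_derive_n (fun u => Im (X u)) n s.

(** A closed curve is a periodic curve on [R]. That [L] is the least period says
    that [s] in [[0, L]] traverses the curve exactly once; with arc length as
    parameter, [L] is the length of the curve. *)
Definition least_period (X : R -> C) (L : R) : Prop :=
  0 < L /\ (forall s, X (s + L) = X s) /\
  (forall P, 0 < P < L -> ~ (forall s, X (s + P) = X s)).

Definition closed_immersed_curve (X : R -> C) (L : R) : Prop :=
  smooth_curve X /\ (forall s, Cmod (CDerive X s) = 1) /\ least_period X L.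

(** Winding number around the origin of a loop [s] in [[0, L]]: the total
    variation of a continuous polar angle, divided by [2 * PI]. In particular
    the loop has to avoid the origin. *)
Definition winding_number (X : R -> C) (L : R) (n : Z) : Prop :=
  (forall s, X s <> RtoC 0) /\
  exists phi : R -> R,
    (forall s, continuous phi s) /\
    (forall s, X s = (RtoC (Cmod (X s)) * cis (phi s))%C) /\
    phi L - phi 0 = 2 * PI * IZR n.

(** The polar angle of the unit vector [dX/ds] is the tangent angle. *)
Definition rotation_number (X : R -> C) (L : R) (n : Z) : Prop :=
  winding_number (CDerive X) L n.

(** For oriented curves parametrized by arc length, the only reparametrizations
    are the changes of the starting point. *)
Definition same_curve (X Y : R -> C) : Prop :=
  exists c : R, forall s, X s = Y (s + c).

(** Rotations about the origin are the multiplications by [z] with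
    [Cmod z = 1]. *)
Definition rotated_copy (X Y : R -> C) : Prop :=
  exists z : C, Cmod z = 1 /\ same_curve (fun s => (z * X s)%C) Y.

Definition rotation_preserves (z : C) (X : R -> C) : Prop :=
  Cmod z = 1 /\ same_curve (fun s => (z * X s)%C) X.

(** The group of rotations preserving [X] is cyclic, with a generator [g] of
    order [q]. *)
Definition rotational_symmetry (q : nat) (X : R -> C) : Prop :=
  exists g : C,
    (forall z : C, rotation_preserves z X <-> exists k : nat, z = (g ^ k)%C) /\
    (g ^ q)%C = RtoC 1 /\
    (forall k : nat, (0 < k < q)%nat -> (g ^ k)%C <> RtoC 1).

(** * Surfaces in space, identified with [C * R] *)

Definition dot3 (a b : C * R) : R := dotC (fst a) (fst b) + snd a * snd b.

Definition Derive3 (f : R -> C * R) (u : R) : C * R :=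
  (CDerive (fun v => fst (f v)) u, Derive (fun v => snd (f v)) u).

Definition partial_s (F : R -> R -> C * R) (s t : R) : C * R :=
  Derive3 (fun u => F u t) s.

Definition partial_t (F : R -> R -> C * R) (s t : R) : C * R :=
  Derive3 (fun v => F s v) t.

(** Divergence along the immersed surface [F] of a vector field [m]:
    the sum of [g^ij <d_i m, d_j F>] over [i, j], where [g^ij] is the inverse of
    the first fundamental form. *)
Definition surface_div (F m : R -> R -> C * R) (s t : R) : R :=
  let Fs := partial_s F s t in
  let Ft := partial_t F s t in
  let ms := partial_s m s t in
  let mt := partial_t m s t in
  let g11 := dot3 Fs Fs in
  let g12 := dot3 Fs Ft in
  let g22 := dot3 Ft Ft in
  (g22 * dot3 ms Fs - g12 * (dot3 ms Ft + dot3 mt Fs) + g11 * dot3 mt Ft)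
    / (g11 * g22 - g12 ^ 2).

Definition helicoidal_surface (h : R) (X : R -> C) (s t : R) : C * R :=
  ((cis t * X s)%C, h * t).

Definition tau (X : R -> C) (s : R) : R := dotC (X s) (CDerive X s).

Definition normal (X : R -> C) (s : R) : C := (Ci * CDerive X s)%C.

(** This is the inward normal [n] when [X] has positive rotation number. *)
Definition inward_normal (h : R) (X : R -> C) (s t : R) : C * R :=
  let w := sqrt (tau X s ^ 2 + h ^ 2) in
  ((RtoC (h / w) * (cis t * normal X s))%C, - tau X s / w).

Definition outward_normal (h : R) (X : R -> C) (s t : R) : C * R :=
  ((- fst (inward_normal h X s t))%C, - snd (inward_normal h X s t)).

Definition generates_CMC (h H : R) (X : R -> C) : Prop :=
  forall s t,
    surface_div (helicoidal_surface h X) (outward_normal h X) s t = H.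

(** A closed immersed curve [X] of length [L] with rotation number [p] and
    [q]-fold rotational symmetry, generating a helicoidal surface of pitch [h]
    and mean curvature [1] with respect to the outward normal. *)
Definition admissible (h : R) (p q : nat) (X : R -> C) (L : R) : Prop :=
  closed_immersed_curve X L /\
  rotation_number X L (Z.of_nat p) /\
  rotational_symmetry q X /\
  generates_CMC h 1 X.

(* Main.v *)
Require Import Defs.
From Stdlib Require Import Reals ZArith.
From Coquelicot Require Import Coquelicot.
From Stdlib Require Import Lra Lia Psatz FunctionalExtensionality.

(** In the moving frame of a unit speed curve [X], with [T = X'] and [N = iT], write
    [X = tau T + nu N] and let [k] be the curvature; then [tau' = 1 + k nu] and
    [nu' = - k tau]. The helicoidal surface of pitch [h] has mean curvature
    [h (k (tau^2 + nu^2 + h^2) + nu) / (tau^2 + h^2)^(3/2)]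
    ([helicoidal_mean_curvature]), so mean curvature one prescribes [k] as a function
    of [tau] and [nu], and the frame coordinates solve an autonomous planar system.

    Put [y = nu / sqrt (tau^2 + h^2)] and [rho = sqrt (1 + y^2)]. The system then
    says that the vector [(h y + 1, - tau rho)] rotates with angular speed [1 / rho].
    Hence it has a constant length [A >= 0] and can be written
    [A (sin psi, cos psi)] with [psi' = 1 / rho]. This integrates the problem: for
    each [A] there is one curve up to rotation and change of the starting point,
    [profile h A], whose phase [psi] is the inverse of the primitive of [rho] and whose
    tangent angle is the primitive of an explicit function [turning] of [psi]
    ([CMC_curve_classification]).

    Let [Theta (A)] be the increment of the tangent angle when [psi] grows by [2 PI]
    ([total_turning]). For [0 < A] the rotations preserving the curve are exactly the
    powers of the rotation by [Theta (A)] ([profile_symmetries]). So the curve is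
    closed with rotation number [p] and a rotation group of order [q] exactly when
    [q Theta (A) = 2 PI p], and for [A = 0] it is a circle. Everything about existence
    and uniqueness is therefore contained in the function [Theta]:
    - [Theta] is strictly decreasing. Up to a term that is the [psi]-derivative of a
      periodic function, the [A]-derivative of [turning] is
      [- A cos^2 psi / (h radius^3)] ([turning_param_decomposition]).
    - [Theta (0) = 2 PI sqrt (h^2 + 1) / h], where [turning] is constant.
    - [Theta (A)] comes below every number above [2 PI]: for large [A], [turning]
      concentrates at the two zeros of [A sin psi - 1] in a period, each of which contributes at most [PI]
      ([total_turning_upper_bound]).
    - [Theta (1) = 2 PI alpha h]: for [A = 1] the curve meets the origin, [turning] is
      [radius / (2 h)], an elliptic integrand, plus the derivative of a function that
      gains [PI] over a period ([total_turning_critical]).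

    Finally [|X|^2 = 1 + A^2 - 2 A sin psi], so the curve meets the origin exactly for
    [A = 1]. For [A < 1] the coordinate [nu] stays negative and the polar angle of [X]
    turns as much as the tangent; for [A > 1] the point [(tau, nu)] goes once around
    the origin in the negative sense during each of the [q] periods. *)

(** * Angles and plane curves *)

Lemma zero_derive_constant (f : R -> R) :
  (forall x, is_derive f x 0) -> forall x y, f x = f y.
Proof.
  intros Hf x y.
  destruct (MVT_gen f x y (fun _ => 0)) as [c [_ Hc]].
  - intros; apply Hf.
  - intros z _; apply continuity_pt_filterlim.
    apply (ex_derive_continuous f); eexists; apply Hf.
  - lra.
Qed.

Lemma is_derive_eq (f g : R -> R) (x l l' : R) :
  is_derive f x l -> (forall t, f t = g t) -> l = l' -> is_derive g x l'.
Proof. intros H E <-. exact (is_derive_ext f g x l E H). Qed.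

Lemma cis_plus (a b : R) : cis (a + b) = (cis a * cis b)%C.
Proof.
  unfold cis, Cmult; simpl. rewrite cos_plus, sin_plus. f_equal; ring.
Qed.

Lemma cis_0 : cis 0 = RtoC 1.
Proof. unfold cis; rewrite cos_0, sin_0; reflexivity. Qed.

Lemma Cmod_cis (a : R) : Cmod (cis a) = 1.
Proof.
  unfold Cmod, cis; simpl.
  replace (cos a * (cos a * 1) + sin a * (sin a * 1)) with 1.
  - apply sqrt_1.
  - generalize (sin2_cos2 a); unfold Rsqr; lra.
Qed.

Lemma cis_neq_0 (a : R) : cis a <> RtoC 0.
Proof. apply Cmod_gt_0. rewrite Cmod_cis; lra. Qed.

Lemma cis_pow (a : R) (n : nat) : (cis a ^ n)%C = cis (INR n * a).
Proof.
  induction n as [|n IH].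
  - simpl. rewrite Rmult_0_l, cis_0; reflexivity.
  - rewrite S_INR, Rmult_plus_distr_r, Rplus_comm, cis_plus, Rmult_1_l, <- IH.
    reflexivity.
Qed.

Lemma cis_period (a : R) (k : Z) : cis (a + 2 * PI * IZR k) = cis a.
Proof.
  assert (Hn : forall b (n : nat), cis (b + 2 * PI * INR n) = cis b).
  { intros b n. unfold cis.
    replace (b + 2 * PI * INR n) with (b + 2 * INR n * PI) by ring.
    now rewrite cos_period, sin_period. }
  destruct k as [|k|k].
  - f_equal; simpl; ring.
  - rewrite <- (positive_nat_Z k), <- INR_IZR_INZ. apply Hn.
  - rewrite <- (Hn (a + 2 * PI * IZR (Z.neg k)) (Pos.to_nat k)). f_equal.
    rewrite INR_IZR_INZ, positive_nat_Z.
    change (Z.neg k) with (- Z.pos k)%Z. rewrite opp_IZR. ring.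
Qed.

Lemma cis_eq_1 (a : R) : cis a = RtoC 1 -> exists k : Z, a = 2 * PI * IZR k.
Proof.
  intros H. assert (Hc : cos a = 1) by (injection H; auto).
  assert (Hs : sin (a / 2) = 0).
  { replace a with (2 * (a / 2)) in Hc by field. rewrite cos_2a_sin in Hc. nra. }
  destruct (sin_eq_0_0 _ Hs) as [k Hk]. exists k. lra.
Qed.

Lemma cis_eq (a b : R) : cis a = cis b -> exists k : Z, a = b + 2 * PI * IZR k.
Proof.
  intros H. destruct (cis_eq_1 (a - b)) as [k Hk].
  - unfold Rminus. rewrite cis_plus, H, <- cis_plus, Rplus_opp_r, cis_0.
    reflexivity.
  - exists k; lra.
Qed.

Lemma unit_cis (z : C) : Cmod z = 1 -> exists a, z = cis a.
Proof.
  intros H. destruct z as [x y].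
  assert (Hxy : x ^ 2 + y ^ 2 = 1).
  { unfold Cmod in H; simpl in H.
    rewrite <- (sqrt_sqrt (x ^ 2 + y ^ 2)) by nra. simpl; rewrite H; ring. }
  assert (Hx : -1 <= x <= 1) by nra.
  assert (Hs : sin (acos x) ^ 2 = y ^ 2).
  { generalize (sin2_cos2 (acos x)); unfold Rsqr. rewrite cos_acos by lra. nra. }
  assert (Hd : (sin (acos x) - y) * (sin (acos x) + y) = 0) by nra.
  apply Rmult_integral in Hd. destruct Hd as [Hd|Hd].
  - exists (acos x). unfold cis. rewrite cos_acos by lra. f_equal; lra.
  - exists (- acos x). unfold cis. rewrite cos_neg, sin_neg, cos_acos by lra.
    f_equal; lra.
Qed.

Lemma polar_vector (A a b : R) :
  0 <= A -> a ^ 2 + b ^ 2 = A ^ 2 -> exists t, a = A * sin t /\ b = A * cos t.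
Proof.
  intros HA H. destruct (Req_dec A 0) as [->|HA0].
  - exists 0. split; nra.
  - destruct (unit_cis (b / A, a / A)) as [t Ht].
    + unfold Cmod; simpl.
      replace (b / A * (b / A * 1) + a / A * (a / A * 1)) with 1.
      * apply sqrt_1.
      * replace (b / A * (b / A * 1) + a / A * (a / A * 1))
          with ((a ^ 2 + b ^ 2) / A ^ 2) by (field; auto).
        rewrite H. field; auto.
    + exists t. injection Ht as Hb Ha.
      split; [rewrite <- Ha | rewrite <- Hb]; field; auto.
Qed.

(** Two continuous polar angles of one curve differ by a multiple of [2 PI] at
    each point, and this multiple cannot jump. *)
Lemma angle_lift_unique (f g : R -> R) :
  (forall s, continuous f s) -> (forall s, continuous g s) ->
  (forall s, cis (f s) = cis (g s)) ->
  forall s t, f s - f t = g s - g t.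
Proof.
  intros Hf Hg H s t.
  set (d := fun s => (f s - g s) / 2).
  assert (Hd : continuity d).
  { intros x. apply continuity_pt_filterlim.
    apply (continuous_scal_l (fun s => f s - g s) (/ 2) x
      (continuous_minus f g x (Hf x) (Hg x))). }
  assert (Hs : forall x, sin (d x) = 0).
  { intros x. destruct (cis_eq _ _ (H x)) as [k Hk].
    unfold d. rewrite Hk.
    replace ((g x + 2 * PI * IZR k - g x) / 2) with (IZR k * PI) by field.
    apply sin_eq_0_1. now exists k. }
  destruct (Req_dec (d s) (d t)) as [E|E].
  { unfold d in E. lra. }
  exfalso.
  (* an intermediate value closer than [PI] to [d s] has a nonzero sine *)
  set (e := Rmin 1 (Rabs (d t - d s))).
  assert (He : 0 < e <= 1).
  { unfold e. generalize (Rmin_l 1 (Rabs (d t - d s))).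
    assert (0 < Rabs (d t - d s)) by (apply Rabs_pos_lt; lra).
    intros; split; [apply Rmin_glb_lt; lra | lra]. }
  assert (He2 : e <= Rabs (d t - d s)) by apply Rmin_r.
  set (y := if Rle_dec (d s) (d t) then d s + e else d s - e).
  assert (Hy : y = d s + e \/ y = d s - e).
  { unfold y. destruct (Rle_dec (d s) (d t)); auto. }
  destruct (IVT_gen d s t y Hd) as [x [_ Hx]].
  { unfold y. destruct (Rle_dec (d s) (d t)) as [L|L].
    - rewrite Rmin_left, Rmax_right by lra. rewrite Rabs_pos_eq in He2; lra.
    - rewrite Rmin_right, Rmax_left by lra. rewrite Rabs_left in He2; lra. }
  assert (Hse : 0 < sin e) by (apply sin_gt_0; generalize PI_4 PI2_1; lra).
  generalize (Hs x) (Hs s) (sin2_cos2 (d s)); rewrite Hx; unfold Rsqr.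
  intros H1 H2 H3. destruct Hy as [Hy|Hy]; rewrite Hy in H1.
  - rewrite sin_plus, H2 in H1. assert (cos (d s) = 0) by nra. nra.
  - rewrite sin_minus, H2 in H1. assert (cos (d s) = 0) by nra. nra.
Qed.

Definition has_cderive (X : R -> C) (s : R) (v : C) : Prop :=
  is_derive (fun u => Re (X u)) s (Re v) /\ is_derive (fun u => Im (X u)) s (Im v).

Lemma CDerive_unique (X : R -> C) (s : R) (v : C) :
  has_cderive X s v -> CDerive X s = v.
Proof.
  intros [H1 H2].
  apply injective_projections; apply is_derive_unique; assumption.
Qed.

Lemma is_derive_Rmult (f g : R -> R) (x df dg : R) :
  is_derive f x df -> is_derive g x dg ->
  is_derive (fun u => f u * g u) x (df * g x + f x * dg).
Proof. intros Hf Hg. apply (is_derive_mult f g x df dg Hf Hg). intros; apply Rmult_comm. Qed.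

Lemma has_cderive_mult (X Y : R -> C) (s : R) (v w : C) :
  has_cderive X s v -> has_cderive Y s w ->
  has_cderive (fun u => X u * Y u)%C s (v * Y s + X s * w)%C.
Proof.
  intros [H1 H2] [H3 H4]. split.
  - replace (Re (v * Y s + X s * w)%C)
      with (Re v * Re (Y s) + Re (X s) * Re w - (Im v * Im (Y s) + Im (X s) * Im w))
      by (unfold Re, Im; simpl; ring).
    exact (is_derive_minus _ _ _ _ _ (is_derive_Rmult _ _ _ _ _ H1 H3)
      (is_derive_Rmult _ _ _ _ _ H2 H4)).
  - replace (Im (v * Y s + X s * w)%C)
      with (Re v * Im (Y s) + Re (X s) * Im w + (Im v * Re (Y s) + Im (X s) * Re w))
      by (unfold Re, Im; simpl; ring).
    exact (is_derive_plus _ _ _ _ _ (is_derive_Rmult _ _ _ _ _ H1 H4)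
      (is_derive_Rmult _ _ _ _ _ H2 H3)).
Qed.

Lemma has_cderive_const (z : C) (s : R) : has_cderive (fun _ => z) s (RtoC 0).
Proof. split; apply @is_derive_const. Qed.

Lemma has_cderive_cis (f : R -> R) (s l : R) :
  is_derive f s l -> has_cderive (fun u => cis (f u)) s (RtoC l * (Ci * cis (f s)))%C.
Proof.
  intros H. assert (D : Derive (fun u => f u) s = l) by exact (is_derive_unique _ _ _ H).
  assert (E := ex_intro _ _ H : ex_derive f s).
  split; simpl; auto_derive; auto; rewrite D; ring.
Qed.

Lemma has_cderive_shift (X : R -> C) (s c : R) (v : C) :
  has_cderive X (s + c) v -> has_cderive (fun u => X (u + c)) s v.
Proof.
  intros [H1 H2].
  assert (D : is_derive (fun u : R => u + c) s 1) by (auto_derive; auto; ring).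
  split.
  - generalize (is_derive_comp (fun u => Re (X u)) (fun u => u + c) s _ _ H1 D).
    unfold scal; simpl; unfold mult; simpl. now rewrite Rmult_1_l.
  - generalize (is_derive_comp (fun u => Im (X u)) (fun u => u + c) s _ _ H2 D).
    unfold scal; simpl; unfold mult; simpl. now rewrite Rmult_1_l.
Qed.

Lemma zero_cderive_constant (X : R -> C) :
  (forall s, has_cderive X s (RtoC 0)) -> forall s t, X s = X t.
Proof.
  intros H s t. apply injective_projections.
  - apply (zero_derive_constant (fun u => Re (X u))). intros; apply H.
  - apply (zero_derive_constant (fun u => Im (X u))). intros; apply H.
Qed.

Lemma polar_form_scale (z : C) (m a : R) :
  0 <= m -> z = (RtoC m * cis a)%C -> z = (RtoC (Cmod z) * cis a)%C.
Proof.
  intros Hm H. rewrite H at 2.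
  rewrite Cmod_mult, Cmod_cis, Cmod_R, Rabs_pos_eq by auto.
  rewrite Rmult_1_r. exact H.
Qed.

(** Within a right angle of the direction [cis a] a polar angle is given by an
    arctangent, so it varies continuously with [z] and [a]. Polar angles along
    whole curves are obtained in this way from an approximate angle [a]. *)
Lemma polar_form_near (z : C) (a : R) :
  0 < dotC z (cis a) ->
  exists m, 0 < m /\
    z = (RtoC m * cis (a + atan (dotC z (Ci * cis a) / dotC z (cis a))))%C.
Proof.
  intros H. set (d := dotC z (cis a)) in *. set (e := dotC z (Ci * cis a)%C).
  set (b := atan (e / d)).
  assert (Hc : 0 < cos b) by (destruct (atan_bound (e / d)); apply cos_gt_0; unfold b; lra).
  assert (Hb : sin b * d = e * cos b).
  { assert (Ht : tan b = e / d) by apply tan_atan. unfold tan in Ht.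
    apply (f_equal (fun x => x * cos b * d)) in Ht.
    replace (sin b / cos b * cos b * d) with (sin b * d) in Ht by (field; lra).
    rewrite Ht. field. lra. }
  exists (d / cos b). split; [apply Rdiv_lt_0_compat; auto|].
  assert (Hz : z = (d * cos a - e * sin a, d * sin a + e * cos a)).
  { generalize (sin2_cos2 a); unfold Rsqr; intros Hsc.
    unfold d, e, dotC, cis, Cmult, Ci; simpl.
    destruct z as [x y]; simpl. f_equal.
    - transitivity (x * (sin a * sin a + cos a * cos a)); [rewrite Hsc|]; ring.
    - transitivity (y * (sin a * sin a + cos a * cos a)); [rewrite Hsc|]; ring. }
  rewrite Hz, cis_plus. unfold cis, Cmult, RtoC; simpl.
  replace e with (sin b * d / cos b) by (rewrite Hb; field; lra).
  f_equal; field; lra.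
Qed.

Lemma dotC_rotate (z v w : C) : Cmod z = 1 -> dotC (z * v)%C (z * w)%C = dotC v w.
Proof.
  intros H. destruct (unit_cis z H) as [a ->].
  generalize (sin2_cos2 a); unfold Rsqr; intros Hsc.
  destruct v as [v1 v2], w as [w1 w2]. unfold dotC, cis, Cmult; simpl.
  replace (v1 * w1 + v2 * w2)
    with ((v1 * w1 + v2 * w2) * (sin a * sin a + cos a * cos a))
    by (rewrite Hsc; ring).
  ring.
Qed.

Lemma CDerive_rotate_shift (z : C) (X Y : R -> C) (c s : R) (v : C) :
  (forall u, Y u = (z * X (u + c)%R)%C) ->
  has_cderive X (s + c) v -> has_cderive Y s (z * v)%C.
Proof.
  intros HY HX.
  assert (H := has_cderive_mult (fun _ => z) (fun u => X (u + c)) s (RtoC 0) v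
    (has_cderive_const z s) (has_cderive_shift X s c v HX)).
  cbv beta in H. rewrite Cmult_0_l, Cplus_0_l in H.
  destruct H as [H1 H2]. split.
  - apply (is_derive_ext (fun u => Re (z * X (u + c)%R)%C)); [|exact H1].
    intros t; now rewrite HY.
  - apply (is_derive_ext (fun u => Im (z * X (u + c)%R)%C)); [|exact H2].
    intros t; now rewrite HY.
Qed.

(** * The mean curvature equation *)

Lemma is_derive_dotC (X Y : R -> C) (s : R) (v w : C) :
  has_cderive X s v -> has_cderive Y s w ->
  is_derive (fun u => dotC (X u) (Y u)) s (dotC v (Y s) + dotC (X s) w).
Proof.
  intros [H1 H2] [H3 H4]. unfold dotC.
  replace (Re v * Re (Y s) + Im v * Im (Y s) + (Re (X s) * Re w + Im (X s) * Im w))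
    with (Re v * Re (Y s) + Re (X s) * Re w + (Im v * Im (Y s) + Im (X s) * Im w)) by ring.
  exact (is_derive_plus _ _ _ _ _ (is_derive_Rmult _ _ _ _ _ H1 H3)
    (is_derive_Rmult _ _ _ _ _ H2 H4)).
Qed.

Lemma unit_dotC (v : C) : Cmod v = 1 -> Re v ^ 2 + Im v ^ 2 = 1.
Proof.
  intros H. destruct (unit_cis v H) as [a ->]. simpl.
  generalize (sin2_cos2 a); unfold Rsqr; lra.
Qed.

Lemma has_cderive_RtoC (f : R -> R) (s l : R) :
  is_derive f s l -> has_cderive (fun u => RtoC (f u)) s (RtoC l).
Proof. intros H; split; [exact H | exact (@is_derive_const R_AbsRing R_NormedModule 0 s)]. Qed.

Lemma has_cderive_opp (X : R -> C) (s : R) (v : C) :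
  has_cderive X s v -> has_cderive (fun u => (- X u)%C) s (- v)%C.
Proof. intros [H1 H2]; split; [exact (is_derive_opp _ _ _ H1) | exact (is_derive_opp _ _ _ H2)]. Qed.

Lemma is_derive_tau (X T : R -> C) (s k : R) :
  has_cderive X s (T s) -> Cmod (T s) = 1 ->
  has_cderive T s (RtoC k * (Ci * T s))%C ->
  is_derive (fun u => dotC (X u) (T u)) s (1 + k * dotC (X s) (Ci * T s)%C).
Proof.
  intros HX H1 HT. generalize (is_derive_dotC _ _ _ _ _ HX HT).
  assert (E := unit_dotC _ H1).
  replace (dotC (T s) (T s) + dotC (X s) (RtoC k * (Ci * T s))%C)
    with (1 + k * dotC (X s) (Ci * T s)%C); auto.
  unfold dotC. rewrite <- E. unfold Re, Im; simpl. ring.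
Qed.

Lemma ex_derive_inv_sqrt (f : R -> R) (h s : R) :
  ex_derive f s -> 0 < f s ^ 2 + h ^ 2 ->
  ex_derive (fun u => h / sqrt (f u ^ 2 + h ^ 2)) s.
Proof.
  intros Hf Hp. auto_derive. repeat split; auto.
  apply Rgt_not_eq, sqrt_lt_R0, Hp.
Qed.

(** With [m] the outward normal and [a = h / sqrt (tau^2 + h^2)], the matrix of the
    products of the derivatives of [m] and [F] has entries [a k], [a], [a] and [- a nu];
    the off-diagonal entry of the first fundamental form is [- nu], and its determinant
    is [tau^2 + h^2]. *)
Lemma helicoidal_mean_curvature (h : R) (X T : R -> C) (k s t : R) :
  0 < h ->
  (forall u, has_cderive X u (T u)) -> (forall u, Cmod (T u) = 1) ->
  has_cderive T s (RtoC k * (Ci * T s))%C ->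
  let tau := dotC (X s) (T s) in
  let nu := dotC (X s) (Ci * T s)%C in
  surface_div (helicoidal_surface h X) (outward_normal h X) s t
  = h * (k * (tau ^ 2 + nu ^ 2 + h ^ 2) + nu) / sqrt (tau ^ 2 + h ^ 2) ^ 3.
Proof.
  intros Hh HX H1 HT tau0 nu0.
  assert (ET : CDerive X = T).
  { apply functional_extensionality; intros u. apply CDerive_unique, HX. }
  assert (Htau := is_derive_tau X T s k (HX s) (H1 s) HT).
  change (is_derive (fun u => dotC (X u) (T u)) s (1 + k * nu0)) in Htau.
  set (w := fun u => sqrt (dotC (X u) (T u) ^ 2 + h ^ 2)).
  assert (Hpos : forall u, 0 < dotC (X u) (T u) ^ 2 + h ^ 2).
  { intros u. generalize (pow2_ge_0 (dotC (X u) (T u))). nra. }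
  assert (Hw : forall u, 0 < w u) by (intros u; apply sqrt_lt_R0, Hpos).
  assert (Hww : w s ^ 2 = tau0 ^ 2 + h ^ 2).
  { apply pow2_sqrt, Rlt_le, (Hpos s). }
  assert (Ha : exists a', is_derive (fun u => h / w u) s a').
  { exact (ex_derive_inv_sqrt (fun u => dotC (X u) (T u)) h s
      (ex_intro _ _ Htau) (Hpos s)). }
  destruct Ha as [a' Ha].
  assert (Hb : is_derive (fun u => dotC (X u) (T u) / w u) s
    (((1 + k * nu0) * (h / w s) + tau0 * a') / h)).
  { apply (is_derive_eq (fun u => dotC (X u) (T u) * (h / w u) * / h) _ _
      (((1 + k * nu0) * (h / w s) + tau0 * a') * / h
         + dotC (X s) (T s) * (h / w s) * 0)).
    - apply (is_derive_Rmult (fun u => dotC (X u) (T u) * (h / w u)) (fun _ => / h)).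
      + exact (is_derive_Rmult _ _ _ _ _ Htau Ha).
      + apply @is_derive_const.
    - intros u. field. split; [generalize (Hw u)|]; lra.
    - unfold Rdiv; ring. }
  assert (Fs : partial_s (helicoidal_surface h X) s t = ((cis t * T s)%C, 0)).
  { unfold partial_s, Derive3, helicoidal_surface; simpl. f_equal.
    - rewrite (CDerive_unique _ _ _ (has_cderive_mult _ _ _ _ _
        (has_cderive_const (cis t) s) (HX s))). ring.
    - apply Derive_const. }
  assert (Ft : partial_t (helicoidal_surface h X) s t = ((Ci * cis t * X s)%C, h)).
  { unfold partial_t, Derive3, helicoidal_surface; simpl. f_equal.
    - assert (I : is_derive (fun u : R => u) t 1) by apply @is_derive_id.
      rewrite (CDerive_unique _ _ _ (has_cderive_mult _ _ _ _ _
        (has_cderive_cis _ _ _ I) (has_cderive_const (X s) t))). ring.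
    - apply is_derive_unique. auto_derive; auto; ring. }
  assert (ms : partial_s (outward_normal h X) s t
    = ((- (RtoC a' * (cis t * (Ci * T s)) - RtoC (h / w s * k) * (cis t * T s)))%C,
       ((1 + k * nu0) * (h / w s) + tau0 * a') / h)).
  { unfold partial_s, Derive3, outward_normal, inward_normal, normal, tau.
    rewrite ET; simpl. f_equal.
    - refine (eq_trans (CDerive_unique _ _ _ (has_cderive_opp _ _ _
        (has_cderive_mult _ _ _ _ _ (has_cderive_RtoC _ _ _ Ha)
        (has_cderive_mult _ _ _ _ _ (has_cderive_const (cis t) s)
        (has_cderive_mult _ _ _ _ _ (has_cderive_const Ci s) HT))))) _).
      apply injective_projections; simpl; ring.
    - apply is_derive_unique.
      eapply is_derive_eq; [exact Hb| |reflexivity].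
      intros u. unfold w. simpl. field. apply Rgt_not_eq, (Hw u). }
  assert (mt : partial_t (outward_normal h X) s t
    = ((RtoC (h / w s) * (cis t * T s))%C, 0)).
  { unfold partial_t, Derive3, outward_normal, inward_normal, normal, tau.
    rewrite ET; simpl. f_equal.
    - assert (I : is_derive (fun u : R => u) t 1) by apply @is_derive_id.
      refine (eq_trans (CDerive_unique _ _ _ (has_cderive_opp _ _ _
        (has_cderive_mult _ _ _ _ _ (has_cderive_const (RtoC (h / w s)) t)
        (has_cderive_mult _ _ _ _ _ (has_cderive_cis _ _ _ I)
        (has_cderive_const (Ci * T s)%C t))))) _).
      apply injective_projections; simpl; ring.
    - apply Derive_const. }
  unfold surface_div. rewrite Fs, Ft, ms, mt.
  fold (w s). change (sqrt (tau0 ^ 2 + h ^ 2)) with (w s).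
  generalize (Hw s) (unit_dotC _ (H1 s)) (sin2_cos2 t) (eq_refl tau0) (eq_refl nu0).
  unfold Rsqr, tau0 at 1, nu0 at 1.
  intros Hw0 E1 E2 Et En.
  assert (E3 : tau0 ^ 2 + nu0 ^ 2 = Re (X s) ^ 2 + Im (X s) ^ 2).
  { rewrite <- (Rmult_1_r (_ + Im (X s) ^ 2)), <- E1.
    unfold tau0, nu0, dotC, Re, Im; simpl. ring. }
  assert (G11 : dot3 ((cis t * T s)%C, 0) ((cis t * T s)%C, 0) = 1).
  { unfold dot3; simpl. rewrite dotC_rotate by apply Cmod_cis.
    unfold dotC. rewrite <- E1. ring. }
  assert (G12 : dot3 ((cis t * T s)%C, 0) ((Ci * cis t * X s)%C, h) = - nu0).
  { unfold dot3; simpl. replace (Ci * cis t * X s)%C with (cis t * (Ci * X s))%C by ring.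
    rewrite dotC_rotate by apply Cmod_cis.
    unfold nu0, dotC, Re, Im; simpl. ring. }
  assert (G22 : dot3 ((Ci * cis t * X s)%C, h) ((Ci * cis t * X s)%C, h)
    = tau0 ^ 2 + nu0 ^ 2 + h ^ 2).
  { rewrite E3. unfold dot3; simpl.
    replace (Ci * cis t * X s)%C with (cis t * (Ci * X s))%C by ring.
    rewrite dotC_rotate by apply Cmod_cis.
    unfold dotC, Re, Im; simpl. ring. }
  rewrite G11, G12, G22.
  clear Fs Ft ms mt G11 G12 G22.
  set (a := h / w s).
  assert (M1 : forall x y, dot3 ((- (RtoC a' * (cis t * (Ci * T s))
      - RtoC (a * k) * (cis t * T s)))%C, x) ((cis t * T s)%C, 0) = a * k /\
    dot3 ((- (RtoC a' * (cis t * (Ci * T s))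
      - RtoC (a * k) * (cis t * T s)))%C, x) ((Ci * cis t * X s)%C, y)
      = - a' * tau0 - a * k * nu0 + x * y).
  { intros x y. unfold dot3; simpl fst; simpl snd.
    replace (- (RtoC a' * (cis t * (Ci * T s)) - RtoC (a * k) * (cis t * T s)))%C
      with (cis t * (- (RtoC a' * (Ci * T s) - RtoC (a * k) * T s)))%C by ring.
    replace (Ci * cis t * X s)%C with (cis t * (Ci * X s))%C by ring.
    rewrite !dotC_rotate by apply Cmod_cis. split.
    - transitivity (a * k * (Re (T s) ^ 2 + Im (T s) ^ 2)); [|rewrite E1; ring].
      unfold dotC, Re, Im; simpl. ring.
    - unfold tau0, nu0, dotC, Re, Im; simpl. ring. }
  assert (M2 : forall y, dot3 ((RtoC a * (cis t * T s))%C, 0) ((cis t * T s)%C, 0) = a /\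
    dot3 ((RtoC a * (cis t * T s))%C, 0) ((Ci * cis t * X s)%C, y) = - a * nu0).
  { intros y. unfold dot3; simpl fst; simpl snd.
    replace (RtoC a * (cis t * T s))%C with (cis t * (RtoC a * T s))%C by ring.
    replace (Ci * cis t * X s)%C with (cis t * (Ci * X s))%C by ring.
    rewrite !dotC_rotate by apply Cmod_cis. split.
    - transitivity (a * (Re (T s) ^ 2 + Im (T s) ^ 2)); [|rewrite E1; ring].
      unfold dotC, Re, Im; simpl. ring.
    - unfold nu0, dotC, Re, Im; simpl. ring. }
  rewrite (proj1 (M1 _ 0)), (proj2 (M1 _ h)), (proj1 (M2 0)), (proj2 (M2 h)).
  unfold a.
  replace (1 * (tau0 ^ 2 + nu0 ^ 2 + h ^ 2) - (- nu0) ^ 2) with (w s ^ 2)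
    by (rewrite Hww; ring).
  field. split; [lra|]. apply Rgt_not_eq; auto.
Qed.

(** * The profile functions and the turning angle of one period *)

(** In terms of [y = nu / sqrt (tau^2 + h^2)], the functions below are [h y],
    [sqrt (|X|^2 + h^2)], [sqrt (1 + y^2) = ds/dpsi] and the derivative of the tangent
    angle in the phase [psi]. *)
Definition height (A psi : R) : R := A * sin psi - 1.

Definition radius (h A psi : R) : R := sqrt (h ^ 2 + 1 + A ^ 2 - 2 * A * sin psi).

Definition stretch (h A psi : R) : R := sqrt (1 + (height A psi / h) ^ 2).

Definition turning (h A psi : R) : R :=
  h * radius h A psi / (h ^ 2 + height A psi ^ 2)
  - height A psi / (h * radius h A psi).

Definition total_turning (h A : R) : R := RInt (turning h A) (- PI / 2) (3 * PI / 2).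

Lemma cos2_sin2 (x : R) : cos x ^ 2 = 1 - sin x ^ 2.
Proof. generalize (sin2_cos2 x); unfold Rsqr; lra. Qed.

Lemma radicand_decomposition (h A psi : R) :
  h ^ 2 + 1 + A ^ 2 - 2 * A * sin psi
  = h ^ 2 + height A psi ^ 2 + A ^ 2 * cos psi ^ 2.
Proof. rewrite cos2_sin2. unfold height. ring. Qed.

Lemma radicand_pos (h A psi : R) : 0 < h -> 0 < h ^ 2 + 1 + A ^ 2 - 2 * A * sin psi.
Proof.
  intros Hh. rewrite radicand_decomposition.
  generalize (pow2_ge_0 (height A psi)) (pow2_ge_0 (A * cos psi)). nra.
Qed.

Lemma radius_pos (h A psi : R) : 0 < h -> 0 < radius h A psi.
Proof. intros; apply sqrt_lt_R0, radicand_pos; auto. Qed.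

Lemma radius_sqr (h A psi : R) :
  0 < h -> radius h A psi ^ 2 = h ^ 2 + 1 + A ^ 2 - 2 * A * sin psi.
Proof. intros; apply pow2_sqrt, Rlt_le, radicand_pos; auto. Qed.

Lemma height_denominator_pos (h A psi : R) : 0 < h -> 0 < h ^ 2 + height A psi ^ 2.
Proof. intros. generalize (pow2_ge_0 (height A psi)). nra. Qed.

Lemma is_derive_height (A psi : R) : is_derive (height A) psi (A * cos psi).
Proof. unfold height. auto_derive; auto; ring. Qed.

Lemma is_derive_radius (h A psi : R) :
  0 < h -> is_derive (radius h A) psi (- A * cos psi / radius h A psi).
Proof.
  intros Hh. generalize (radius_pos h A psi Hh) (radicand_pos h A psi Hh).
  unfold radius. intros H1 H2. auto_derive.
  - replace (h * (h * 1) + 1 + A * (A * 1) + - (2 * A * sin psi))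
      with (h ^ 2 + 1 + A ^ 2 - 2 * A * sin psi) by ring. exact H2.
  - replace (h * (h * 1) + 1 + A * (A * 1) + - (2 * A * sin psi))
      with (h ^ 2 + 1 + A ^ 2 - 2 * A * sin psi) by ring. field. lra.
Qed.

Lemma is_derive_radius_param (h A psi : R) :
  0 < h -> is_derive (fun a => radius h a psi) A ((A - sin psi) / radius h A psi).
Proof.
  intros Hh. generalize (radius_pos h A psi Hh) (radicand_pos h A psi Hh).
  unfold radius. intros H1 H2. auto_derive.
  - replace (h * (h * 1) + 1 + A * (A * 1) + - (2 * A * sin psi))
      with (h ^ 2 + 1 + A ^ 2 - 2 * A * sin psi) by ring. exact H2.
  - replace (h * (h * 1) + 1 + A * (A * 1) + - (2 * A * sin psi))
      with (h ^ 2 + 1 + A ^ 2 - 2 * A * sin psi) by ring. field. lra.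
Qed.

Lemma is_derive_turning_param (h A psi : R) :
  0 < h -> is_derive (fun a => turning h a psi) A
    (h * ((A - sin psi) / radius h A psi) / (h ^ 2 + height A psi ^ 2)
     - 2 * h * radius h A psi * height A psi * sin psi / (h ^ 2 + height A psi ^ 2) ^ 2
     - (sin psi / radius h A psi
        - height A psi * ((A - sin psi) / radius h A psi) / radius h A psi ^ 2) / h).
Proof.
  intros Hh. assert (Hr := is_derive_radius_param h A psi Hh).
  assert (Hp := radius_pos h A psi Hh).
  assert (Hq := height_denominator_pos h A psi Hh).
  assert (D := is_derive_unique _ _ _ Hr).
  set (r := fun a => radius h a psi) in *.
  change (radius h A psi) with (r A) in *.
  apply (is_derive_eq (fun a => h * r a / (h ^ 2 + (a * sin psi - 1) ^ 2)
     - (a * sin psi - 1) / (h * r a)) _ _ (h * ((A - sin psi) / r A) / (h ^ 2 + height A psi ^ 2)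
     - 2 * h * r A * height A psi * sin psi / (h ^ 2 + height A psi ^ 2) ^ 2
     - (sin psi / r A
        - height A psi * ((A - sin psi) / r A) / r A ^ 2) / h)).
  - unfold height in *. auto_derive.
    + repeat split; try (eexists; exact Hr); simpl in *; try lra.
      nra.
    + replace (Derive (fun x : R => r x) A) with ((A - sin psi) / r A)
        by (symmetry; exact D).
      simpl in *. field. repeat split; simpl; try lra.
  - reflexivity.
  - reflexivity.
Qed.

(** This function is [2 PI]-periodic in [psi], so its [psi]-derivative integrates to
    zero over a period. *)
Definition turning_gauge (h A psi : R) : R :=
  h * A * sin psi * cos psi / (radius h A psi * (h ^ 2 + height A psi ^ 2)).

Definition turning_decay (h A psi : R) : R :=
  A * cos psi ^ 2 / (h * radius h A psi ^ 3).

(** This is where the monotonicity of the total turning comes from: [turning_decay] is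
    nonnegative, and what remains of the [A]-derivative is exact. *)
Lemma turning_param_decomposition (h A psi : R) :
  0 < h -> is_derive (turning_gauge h A) psi
    (Derive (fun a => turning h a psi) A + turning_decay h A psi).
Proof.
  intros Hh.
  assert (E : Derive (fun a => turning h a psi) A = _)
    by exact (is_derive_unique _ _ _ (is_derive_turning_param h A psi Hh)).
  rewrite E; clear E.
  assert (Hr := is_derive_radius h A psi Hh).
  assert (Hp := radius_pos h A psi Hh).
  assert (Hq := height_denominator_pos h A psi Hh).
  assert (Hs := radius_sqr h A psi Hh).
  assert (Hc := cos2_sin2 psi).
  assert (D := is_derive_unique _ _ _ Hr).
  unfold turning_gauge, turning_decay, height in *.
  set (r := radius h A) in *.
  auto_derive.
  - repeat split; try (eexists; exact Hr).
    apply Rmult_integral_contrapositive_currified; simpl in *; lra.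
  - replace (Derive (fun x : R => r x) psi) with (- A * cos psi / r psi)
      by (symmetry; exact D).
    field_simplify_eq [Hs Hc].
    2: repeat split; simpl in *; lra.
    ring [Hs Hc].
Qed.

Lemma continuous_of_is_derive (f : R -> R) (x l : R) : is_derive f x l -> continuous f x.
Proof. intros H; apply @ex_derive_continuous; now exists l. Qed.

Lemma continuous_height (A psi : R) : continuous (height A) psi.
Proof. exact (continuous_of_is_derive _ _ _ (is_derive_height A psi)). Qed.

Lemma continuous_radius (h A psi : R) : 0 < h -> continuous (radius h A) psi.
Proof. intros; eapply continuous_of_is_derive, is_derive_radius; auto. Qed.

Lemma ex_derive_turning (h A psi : R) : 0 < h -> ex_derive (turning h A) psi.
Proof.
  intros Hh. assert (Hr := is_derive_radius h A psi Hh).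
  assert (Hp := radius_pos h A psi Hh).
  assert (Hq := height_denominator_pos h A psi Hh).
  unfold turning, height in *.
  set (r := radius h A) in *.
  auto_derive. repeat split; try (eexists; exact Hr); simpl in *; try lra; nra.
Qed.

Lemma continuous_turning (h A psi : R) : 0 < h -> continuous (turning h A) psi.
Proof. intros; apply @ex_derive_continuous, ex_derive_turning; auto. Qed.

Lemma ex_RInt_turning (h A a b : R) : 0 < h -> ex_RInt (turning h A) a b.
Proof. intros; apply @ex_RInt_continuous; intros; apply continuous_turning; auto. Qed.

Lemma continuous_turning_decay (h A psi : R) :
  0 < h -> continuous (turning_decay h A) psi.
Proof.
  intros Hh. assert (Hr := is_derive_radius h A psi Hh).
  assert (Hp := radius_pos h A psi Hh).
  apply @ex_derive_continuous. unfold turning_decay.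
  set (r := radius h A) in *. auto_derive. repeat split; try (eexists; exact Hr).
  apply Rgt_not_eq. repeat apply Rmult_lt_0_compat; lra.
Qed.

Lemma cos_left_end : cos (- PI / 2) = 0.
Proof. replace (- PI / 2) with (- (PI / 2)) by field. rewrite cos_neg. apply cos_PI2. Qed.

Lemma sin_left_end : sin (- PI / 2) = -1.
Proof. replace (- PI / 2) with (- (PI / 2)) by field. rewrite sin_neg, sin_PI2. reflexivity. Qed.

Lemma cos_right_end : cos (3 * PI / 2) = 0.
Proof. replace (3 * PI / 2) with (3 * (PI / 2)) by field. apply cos_3PI2. Qed.

Lemma cos_right_half (x : R) : - PI / 2 < x < PI / 2 -> 0 < cos x.
Proof. intros; apply cos_gt_0; lra. Qed.

Lemma cos_left_half (x : R) : PI / 2 < x < 3 * PI / 2 -> cos x < 0.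
Proof. intros; apply cos_lt_0; lra. Qed.

Lemma turning_decay_integral_pos (h A : R) :
  0 < h -> 0 < A -> 0 < RInt (turning_decay h A) (- PI / 2) (3 * PI / 2).
Proof.
  intros Hh HA. assert (Hpi := PI_RGT_0).
  assert (Hex : forall a b, ex_RInt (turning_decay h A) a b).
  { intros; apply @ex_RInt_continuous; intros; apply continuous_turning_decay; auto. }
  assert (Hpos : forall x, cos x <> 0 -> 0 < turning_decay h A x).
  { intros x Hx. assert (Hp := radius_pos h A x Hh). unfold turning_decay.
    apply Rdiv_lt_0_compat.
    - apply Rmult_lt_0_compat; auto. apply pow2_gt_0; auto.
    - apply Rmult_lt_0_compat; auto. apply pow_lt; auto. }
  rewrite <- (RInt_Chasles _ (- PI / 2) (PI / 2)) by auto.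
  apply Rplus_lt_0_compat; apply RInt_gt_0; try lra.
  - intros x Hx. apply Hpos. generalize (cos_right_half x Hx); lra.
  - intros; apply continuous_turning_decay; auto.
  - intros x Hx. apply Hpos. generalize (cos_left_half x Hx); lra.
  - intros; apply continuous_turning_decay; auto.
Qed.

Lemma continuity_2d_pt_Derive_turning (h A psi : R) :
  0 < h ->
  continuity_2d_pt (fun a t => Derive (fun z => turning h z t) a) A psi.
Proof.
  intros Hh.
  eapply continuity_2d_pt_ext.
  { intros a t. symmetry. apply is_derive_unique, is_derive_turning_param, Hh. }
  assert (Cs : continuity_2d_pt (fun _ t => sin t) A psi).
  { apply (continuity_1d_2d_pt_comp sin (fun _ t => t)).
    - apply continuity_sin.
    - apply continuity_2d_pt_id2. }
  assert (Ca : continuity_2d_pt (fun a _ => a) A psi) by apply continuity_2d_pt_id1.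
  assert (Cc : forall c, continuity_2d_pt (fun _ _ => c) A psi)
    by (intros; apply continuity_2d_pt_const).
  assert (CV : continuity_2d_pt height A psi).
  { apply continuity_2d_pt_minus; auto. apply continuity_2d_pt_mult; auto. }
  assert (C2 : forall f, continuity_2d_pt f A psi ->
    continuity_2d_pt (fun a t => f a t ^ 2) A psi).
  { intros f Hf. apply continuity_2d_pt_mult; auto. apply continuity_2d_pt_mult; auto. }
  assert (CR : continuity_2d_pt (radius h) A psi).
  { apply (continuity_1d_2d_pt_comp sqrt
      (fun a t => h ^ 2 + 1 + a ^ 2 - 2 * a * sin t)).
    - apply continuity_pt_filterlim, continuous_sqrt.
    - apply continuity_2d_pt_minus.
      + apply continuity_2d_pt_plus; auto.
      + apply continuity_2d_pt_mult; auto. apply continuity_2d_pt_mult; auto. }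
  assert (Hp := radius_pos h A psi Hh).
  assert (Hq := height_denominator_pos h A psi Hh).
  assert (CQ : continuity_2d_pt (fun a t => h ^ 2 + height a t ^ 2) A psi)
    by (apply continuity_2d_pt_plus; auto).
  assert (CD : forall f g, continuity_2d_pt f A psi -> continuity_2d_pt g A psi ->
    g A psi <> 0 -> continuity_2d_pt (fun a t => f a t / g a t) A psi).
  { intros f g Hf Hg Hn. apply continuity_2d_pt_mult; auto.
    apply continuity_2d_pt_inv; auto. }
  assert (CM : continuity_2d_pt (fun a t => (a - sin t) / radius h a t) A psi).
  { apply CD; auto; [apply continuity_2d_pt_minus; auto | lra]. }
  apply continuity_2d_pt_minus; [apply continuity_2d_pt_minus|].
  - apply CD; auto; [apply continuity_2d_pt_mult; auto | lra].
  - apply CD; auto.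
    + repeat apply continuity_2d_pt_mult; auto.
    + apply pow_nonzero; lra.
  - apply CD; auto; [|lra].
    apply continuity_2d_pt_minus.
    + apply CD; auto. lra.
    + apply CD; auto; [apply continuity_2d_pt_mult; auto|]. apply pow_nonzero; lra.
Qed.

Lemma continuous_of_continuity_2d (f : R -> R -> R) (x y : R) :
  continuity_2d_pt f x y -> continuous (f x) y.
Proof.
  intros H P [eps HP]. destruct (H eps) as [d Hd].
  exists d. intros t Ht. apply HP, (Hd x t).
  - rewrite Rminus_eq_0, Rabs_R0. apply cond_pos.
  - exact Ht.
Qed.

Lemma is_derive_total_turning (h A : R) :
  0 < h ->
  is_derive (total_turning h) A (- RInt (turning_decay h A) (- PI / 2) (3 * PI / 2)).
Proof.
  intros Hh.
  set (dK := fun psi => Derive (fun a => turning h a psi) A).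
  assert (CdK : forall psi, continuous dK psi).
  { intros psi. apply (continuous_of_continuity_2d (fun a t => Derive (fun z => turning h z t) a)).
    apply continuity_2d_pt_Derive_turning; auto. }
  assert (Hd : is_derive (total_turning h) A (RInt dK (- PI / 2) (3 * PI / 2))).
  { apply is_derive_RInt_param.
    - apply filter_forall. intros a t _. eexists. apply is_derive_turning_param; auto.
    - intros t _. apply continuity_2d_pt_Derive_turning; auto.
    - apply filter_forall. intros a. apply ex_RInt_turning; auto. }
  replace (- RInt (turning_decay h A) (- PI / 2) (3 * PI / 2))
    with (RInt dK (- PI / 2) (3 * PI / 2)); auto.
  assert (E1 : ex_RInt dK (- PI / 2) (3 * PI / 2)).
  { apply @ex_RInt_continuous; intros; auto. }
  assert (E2 : ex_RInt (turning_decay h A) (- PI / 2) (3 * PI / 2)).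
  { apply @ex_RInt_continuous; intros; apply continuous_turning_decay; auto. }
  assert (Hg : is_RInt (fun psi => dK psi + turning_decay h A psi)
    (- PI / 2) (3 * PI / 2)
    (turning_gauge h A (3 * PI / 2) - turning_gauge h A (- PI / 2))).
  { apply (is_RInt_derive (turning_gauge h A)).
    - intros; apply turning_param_decomposition; auto.
    - intros x _. apply @continuous_plus; auto.
      apply continuous_turning_decay; auto. }
  assert (Hs := is_RInt_plus _ _ _ _ _ _ (RInt_correct _ _ _ E1) (RInt_correct _ _ _ E2)).
  assert (E := eq_trans (eq_sym (is_RInt_unique _ _ _ _ Hs)) (is_RInt_unique _ _ _ _ Hg)).
  unfold turning_gauge in E. rewrite cos_left_end, cos_right_end in E.
  unfold plus in E; simpl in E. unfold Rdiv in *. lra.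
Qed.

Lemma total_turning_decreasing (h A B : R) :
  0 < h -> 0 <= A < B -> total_turning h B < total_turning h A.
Proof.
  intros Hh HAB.
  destruct (MVT_cor2 (total_turning h)
    (fun a => - RInt (turning_decay h a) (- PI / 2) (3 * PI / 2)) A B) as [c [Hc1 Hc2]].
  - lra.
  - intros; apply is_derive_Reals, is_derive_total_turning; auto.
  - assert (Hp := turning_decay_integral_pos h c Hh ltac:(lra)). nra.
Qed.

Lemma total_turning_0 (h : R) :
  0 < h -> total_turning h 0 = 2 * PI * (sqrt (h ^ 2 + 1) / h).
Proof.
  intros Hh. unfold total_turning.
  assert (E : turning h 0 = fun _ => sqrt (h ^ 2 + 1) / h).
  { apply functional_extensionality; intros x.
    assert (Hp := radius_pos h 0 x Hh). assert (Hs := radius_sqr h 0 x Hh).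
    assert (Er : radius h 0 x = sqrt (h ^ 2 + 1)).
    { unfold radius. f_equal. ring. }
    unfold turning. rewrite Er in *. unfold height.
    set (r := sqrt (h ^ 2 + 1)) in *.
    replace (h ^ 2 + (0 * sin x - 1) ^ 2) with (r ^ 2) by (rewrite Hs; ring).
    apply Rminus_diag_uniq. field_simplify_eq; [|lra]. rewrite Hs. ring. }
  rewrite E, RInt_const. unfold scal; simpl; unfold mult; simpl. field. lra.
Qed.

Lemma radius_lower_bound (h A psi : R) : 0 < h -> 1 < A -> A - 1 < radius h A psi.
Proof.
  intros Hh HA. assert (Hp := radius_pos h A psi Hh). assert (Hs := radius_sqr h A psi Hh).
  assert (Hb := SIN_bound psi).
  destruct (Rlt_or_le (A - 1) (radius h A psi)) as [L|L]; auto.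
  exfalso. assert (radius h A psi ^ 2 <= (A - 1) ^ 2) by (apply pow_incr; lra). nra.
Qed.

(** For large [A] the curvature concentrates where [height] vanishes; there
    [turning] is close to the derivative of [e * atan (height / h)], where [e] is the
    sign of the cosine. *)
Lemma turning_upper_bound (h A e psi : R) :
  0 < h -> 1 < A -> e ^ 2 = 1 -> 0 <= e * cos psi ->
  exists d : R,
    is_derive (fun x => e * atan (height A x / h) + A / h * (cos x / radius h A x)) psi d
    /\ turning h A psi <= d + (h ^ 2 + 1) / (h * (A - 1)).
Proof.
  intros Hh HA He Hc.
  assert (Hr := is_derive_radius h A psi Hh).
  assert (Hp := radius_pos h A psi Hh). assert (Hs := radius_sqr h A psi Hh).
  assert (Hq := height_denominator_pos h A psi Hh).
  assert (Hl := radius_lower_bound h A psi Hh HA).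
  assert (Hc2 := cos2_sin2 psi).
  exists (e * (h * A * cos psi / (h ^ 2 + height A psi ^ 2))
    + A / h * (- sin psi / radius h A psi + A * cos psi ^ 2 / radius h A psi ^ 3)).
  split.
  - assert (D := is_derive_unique _ _ _ Hr).
    unfold height in *. set (r := radius h A) in *.
    auto_derive.
    + repeat split; try (eexists; exact Hr); lra.
    + replace (Derive (fun x : R => r x) psi) with (- A * cos psi / r psi)
        by (symmetry; exact D).
      unfold Rsqr. field. repeat split; simpl in *; try lra.
  - set (r := radius h A psi) in *. set (V := height A psi) in *. set (c := cos psi) in *.
    assert (HV : A * sin psi = V + 1) by (unfold V, height; ring).
    assert (Hrc : r ^ 2 = h ^ 2 + V ^ 2 + A ^ 2 * c ^ 2).
    { rewrite Hs. unfold V, c. apply radicand_decomposition. }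
    assert (Hec : (e * c) ^ 2 = c ^ 2) by (rewrite Rpow_mult_distr, He; ring).
    assert (HAc : 0 <= A * (e * c)) by (apply Rmult_le_pos; lra).
    assert (T1 : h * r / (h ^ 2 + V ^ 2)
      = e * (h * A * c / (h ^ 2 + V ^ 2)) + h / (r + A * (e * c))).
    { assert (Hd : h ^ 2 + V ^ 2 = (r - A * (e * c)) * (r + A * (e * c))).
      { transitivity (r ^ 2 - A ^ 2 * (e * c) ^ 2); [rewrite Hec, Hrc|]; ring. }
      rewrite Hd in *. field. split; [lra|]. intros E. rewrite E in Hq. lra. }
    assert (T2 : h / (r + A * (e * c)) <= h / (A - 1)).
    { apply Rmult_le_compat_l; [lra|]. apply Rinv_le_contravar; lra. }
    assert (T3 : - V / (h * r) <= A / h * (- sin psi / r + A * c ^ 2 / r ^ 3) + / (h * (A - 1))).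
    { replace (- V / (h * r)) with (/ (h * r) - A / h * (sin psi / r)).
      2:{ unfold V, height. field. lra. }
      assert (/ (h * r) <= / (h * (A - 1))).
      { apply Rinv_le_contravar; [apply Rmult_lt_0_compat; lra|].
        apply Rmult_le_compat_l; lra. }
      assert (0 <= A / h * (A * c ^ 2 / r ^ 3)).
      { assert (0 < r ^ 3) by (apply pow_lt; auto).
        assert (Hcc := pow2_ge_0 c).
        apply Rmult_le_pos; apply Rdiv_le_0_compat; try lra.
        apply Rmult_le_pos; lra. }
      unfold Rdiv in *. lra. }
    unfold turning. fold r V c.
    replace ((h ^ 2 + 1) / (h * (A - 1))) with (h / (A - 1) + / (h * (A - 1)))
      by (field; lra).
    rewrite T1. unfold Rdiv in *. lra.
Qed.

(** On each half period [turning_upper_bound] applies with a fixed sign of the cosine,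
    and the arctangent there increases by less than [PI]. *)
Lemma total_turning_upper_bound (h A : R) :
  0 < h -> 1 < A ->
  total_turning h A < 2 * PI * (1 + (h ^ 2 + 1) / (h * (A - 1))).
Proof.
  intros Hh HA. assert (Hpi := PI_RGT_0).
  set (c := (h ^ 2 + 1) / (h * (A - 1))).
  assert (half : forall e a b, a < b -> e ^ 2 = 1 ->
    (forall x, a <= x <= b -> 0 <= e * cos x) -> cos a = 0 -> cos b = 0 ->
    RInt (turning h A) a b
      <= e * (atan (height A b / h) - atan (height A a / h)) + c * (b - a)).
  { intros e a b Hab He Hcos Ha Hb.
    set (g := fun x => e * atan (height A x / h) + A / h * (cos x / radius h A x)).
    assert (Hg : forall x, a <= x <= b ->
      exists d : R, is_derive g x d /\ turning h A x <= d + c).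
    { intros x Hx. apply turning_upper_bound; auto. }
    assert (Hmon : forall x, a <= x <= b -> is_derive
       (fun y => g y + c * y - RInt (turning h A) a y) x (Derive g x + c - turning h A x)).
    { intros x Hx. destruct (Hg x Hx) as [d [Hd _]].
      assert (Hg' : is_derive g x (Derive g x)) by (apply Derive_correct; now exists d).
      assert (H1 : is_derive (fun y => c * y) x c) by (auto_derive; auto; ring).
      assert (H2 : is_derive (fun y => RInt (turning h A) a y) x (turning h A x)).
      { apply (is_derive_RInt (turning h A) (fun y => RInt (turning h A) a y) a).
        - apply filter_forall. intros y. apply (@RInt_correct R_CompleteNormedModule), ex_RInt_turning; auto.
        - apply continuous_turning; auto. }
      exact (is_derive_minus _ _ _ _ _ (is_derive_plus _ _ _ _ _ Hg' H1) H2). }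
    destruct (MVT_gen _ a b _ (fun x Hx => Hmon x ltac:(
        rewrite Rmin_left, Rmax_right in Hx; lra))) as [x [Hx E]].
    { intros x Hx. rewrite Rmin_left, Rmax_right in Hx by lra.
      apply continuity_pt_filterlim. exact (continuous_of_is_derive _ _ _ (Hmon x Hx)). }
    rewrite Rmin_left, Rmax_right in Hx by lra.
    destruct (Hg x Hx) as [d [Hd Hle]].
    rewrite (is_derive_unique _ _ _ Hd) in E.
    rewrite RInt_point in E. unfold g in E. rewrite Ha, Hb in E.
    unfold zero in E; simpl in E.
    assert (0 <= (d + c - turning h A x) * (b - a)) by (apply Rmult_le_pos; lra).
    unfold Rdiv in *. lra. }
  unfold total_turning.
  rewrite <- (RInt_Chasles _ (- PI / 2) (PI / 2)) by (apply ex_RInt_turning; auto).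
  assert (B1 := half 1 (- PI / 2) (PI / 2) ltac:(lra) ltac:(ring)
    ltac:(intros; rewrite Rmult_1_l; apply cos_ge_0; lra) cos_left_end cos_PI2).
  assert (B2 := half (-1) (PI / 2) (3 * PI / 2) ltac:(lra) ltac:(ring)
    ltac:(intros; assert (cos x <= 0) by (apply cos_le_0; lra); lra)
    cos_PI2 cos_right_end).
  unfold plus; simpl.
  generalize (atan_bound (height A (PI / 2) / h)) (atan_bound (height A (- PI / 2) / h))
   (atan_bound (height A (3 * PI / 2) / h)).
  fold c. intros. unfold Rdiv in *. lra.
Qed.

Lemma total_turning_surjective (h x : R) :
  0 < h -> 1 < x < sqrt (h ^ 2 + 1) / h ->
  exists A, 0 < A /\ total_turning h A = 2 * PI * x.
Proof.
  intros Hh Hx. assert (Hpi := PI_RGT_0).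
  set (B := 2 + (h ^ 2 + 1) / (h * (x - 1))).
  assert (HB : 0 < (h ^ 2 + 1) / (h * (x - 1))).
  { apply Rdiv_lt_0_compat; [nra | apply Rmult_lt_0_compat; lra]. }
  assert (H0 := total_turning_0 h Hh).
  assert (H1 : total_turning h B < 2 * PI * x).
  { eapply Rlt_trans; [apply total_turning_upper_bound; auto; unfold B; lra|].
    apply Rmult_lt_compat_l; [lra|].
    assert ((h ^ 2 + 1) / (h * (B - 1)) < x - 1); [|lra].
    apply (Rmult_lt_reg_r (h * (B - 1))); [apply Rmult_lt_0_compat; unfold B; lra|].
    replace ((h ^ 2 + 1) / (h * (B - 1)) * (h * (B - 1))) with (h ^ 2 + 1)
      by (field; unfold B; lra).
    replace ((x - 1) * (h * (B - 1))) with (h * (x - 1) + (h ^ 2 + 1))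
      by (unfold B; field; lra).
    assert (0 < h * (x - 1)) by (apply Rmult_lt_0_compat; lra). lra. }
  destruct (IVT_gen (total_turning h) 0 B (2 * PI * x)) as [A [HA1 HA2]].
  - intros a. apply continuity_pt_filterlim.
    eapply continuous_of_is_derive, is_derive_total_turning, Hh.
  - assert (2 * PI * x < total_turning h 0).
    { rewrite H0. apply Rmult_lt_compat_l; lra. }
    rewrite Rmin_right, Rmax_left by lra. lra.
  - exists A. split; auto.
    rewrite Rmin_left in HA1 by (unfold B; lra).
    destruct (Req_dec A 0) as [->|]; [|lra].
    rewrite H0 in HA2. apply Rmult_eq_reg_l in HA2; lra.
Qed.

Lemma elliptic_integrand_pos (h y : R) :
  0 < h -> 0 < 1 - (2 / sqrt (h ^ 2 + 4)) ^ 2 * sin y ^ 2.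
Proof.
  intros Hh. unfold Rdiv. rewrite Rpow_mult_distr, pow_inv, pow2_sqrt by nra.
  assert (H : sin y ^ 2 <= 1) by (generalize (cos2_sin2 y) (pow2_ge_0 (cos y)); lra).
  apply (Rmult_lt_reg_l (h ^ 2 + 4)); [nra|].
  replace ((h ^ 2 + 4) * (1 - 2 ^ 2 * / (h ^ 2 + 4) * sin y ^ 2))
    with (h ^ 2 + 4 - 4 * sin y ^ 2) by (field; nra). nra.
Qed.

(** The half angle substitution [psi = 2 y - PI / 2] brings the integrand to the
    Legendre form. *)
Lemma radius_critical (h y : R) :
  0 < h ->
  radius h 1 (2 * y + - PI / 2)
  = sqrt (h ^ 2 + 4) * sqrt (1 - (2 / sqrt (h ^ 2 + 4)) ^ 2 * sin y ^ 2).
Proof.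
  intros Hh. rewrite <- sqrt_mult.
  - unfold radius. f_equal.
    unfold Rdiv at 2. rewrite Rpow_mult_distr, pow_inv, pow2_sqrt by nra.
    replace (2 * y + - PI / 2) with (- (PI / 2 - 2 * y)) by field.
    rewrite sin_neg, sin_shift, cos_2a_sin. field. nra.
  - nra.
  - apply Rlt_le, elliptic_integrand_pos, Hh.
Qed.

Lemma RInt_Rmult (k a b : R) (f : R -> R) :
  ex_RInt f a b -> RInt (fun y => k * f y) a b = k * RInt f a b.
Proof. exact (RInt_scal f a b k). Qed.

Lemma radius_critical_integral (h : R) :
  0 < h ->
  RInt (radius h 1) (- PI / 2) (3 * PI / 2)
  = 4 * sqrt (h ^ 2 + 4) * ellipticE (2 / sqrt (h ^ 2 + 4)).
Proof.
  intros Hh. set (k := 2 / sqrt (h ^ 2 + 4)).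
  set (g := fun y => sqrt (1 - k ^ 2 * sin y ^ 2)).
  assert (Eg : forall a b, ex_RInt g a b).
  { intros a b. apply @ex_RInt_continuous. intros y _.
    apply @ex_derive_continuous. unfold g. auto_derive. simpl.
    generalize (elliptic_integrand_pos h y Hh). fold k. simpl. lra. }
  assert (ER : forall a b, ex_RInt (radius h 1) a b).
  { intros; apply @ex_RInt_continuous; intros; apply continuous_radius, Hh. }
  assert (H1 : RInt (fun y => 2 * radius h 1 (2 * y + - PI / 2)) 0 PI
    = RInt (radius h 1) (- PI / 2) (3 * PI / 2)).
  { generalize (RInt_comp_lin (radius h 1) 2 (- PI / 2) 0 PI (ER _ _)).
    replace (2 * 0 + - PI / 2) with (- PI / 2) by ring.
    replace (2 * PI + - PI / 2) with (3 * PI / 2) by field. auto. }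
  rewrite <- H1.
  rewrite (RInt_ext _ (fun y => 2 * sqrt (h ^ 2 + 4) * g y)).
  2:{ intros y _. rewrite radius_critical by auto. fold k.
      change (2 * (sqrt (h ^ 2 + 4) * g y) = 2 * sqrt (h ^ 2 + 4) * g y). ring. }
  rewrite RInt_Rmult by auto.
  assert (H2 : RInt g (PI / 2) PI = RInt g 0 (PI / 2)).
  { generalize (RInt_comp_lin g (-1) PI 0 (PI / 2) (Eg _ _)).
    replace (-1 * 0 + PI) with PI by ring.
    replace (-1 * (PI / 2) + PI) with (PI / 2) by field.
    rewrite (RInt_ext _ (fun y => -1 * g y)).
    2:{ intros y _. unfold g.
        replace (-1 * y + PI) with (PI - y) by ring.
        rewrite sin_PI_x. reflexivity. }
    rewrite RInt_Rmult by auto.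
    generalize (opp_RInt_swap g (PI / 2) PI (Eg _ _)).
    unfold opp; simpl. lra. }
  rewrite <- (RInt_Chasles g 0 (PI / 2) PI) by auto. rewrite H2.
  unfold ellipticE. fold k g. unfold scal, plus; simpl; unfold mult; simpl. ring.
Qed.

(** When [A = 1] the curve meets the origin and its polar angle jumps by [PI]. The
    function below is the tangent angle minus a continuous choice of this polar
    angle, in the half angle of [psi]. *)
Definition critical_gauge (h psi : R) : R :=
  psi / 2 + atan (- (radius h 1 psi - h) * cos psi
    / (h * (1 + sin psi) + radius h 1 psi * (1 - sin psi))).

Lemma is_derive_critical_gauge (h psi : R) :
  0 < h ->
  is_derive (critical_gauge h) psi (turning h 1 psi - radius h 1 psi / (2 * h)).
Proof.
  intros Hh. assert (Hr := is_derive_radius h 1 psi Hh).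
  assert (Hp := radius_pos h 1 psi Hh). assert (Hs := radius_sqr h 1 psi Hh).
  assert (Hq := height_denominator_pos h 1 psi Hh).
  assert (Hc2 := cos2_sin2 psi).
  assert (D := is_derive_unique _ _ _ Hr).
  assert (Hd : 0 < h * (1 + sin psi) + radius h 1 psi * (1 - sin psi)).
  { generalize (SIN_bound psi). nra. }
  unfold critical_gauge, turning.
  set (r := radius h 1) in *.
  auto_derive.
  - repeat split; try (eexists; exact Hr); lra.
  - replace (Derive (fun x : R => r x) psi) with (- 1 * cos psi / r psi)
      by (symmetry; exact D).
    set (d := h * (1 + sin psi) + r psi * (1 - sin psi)) in *.
    assert (Hn : d ^ 2 + (- (r psi - h) * cos psi) ^ 2
      = 4 * (h ^ 2 + height 1 psi ^ 2)).
    { unfold d, height. ring [Hs Hc2]. }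
    set (q := h ^ 2 + height 1 psi ^ 2) in *.
    replace (1 + (- (r psi - h) * cos psi * / d)²) with (4 * q / d ^ 2).
    2:{ rewrite <- Hn. unfold Rsqr. field. lra. }
    replace (h * (1 + sin psi) + r psi * (1 + - sin psi)) with d by (unfold d; ring).
    field_simplify_eq; [|lra].
    unfold d, q, height. ring [Hs Hc2].
Qed.

Lemma total_turning_critical (h : R) : 0 < h -> total_turning h 1 = 2 * PI * alpha h.
Proof.
  intros Hh. assert (Hpi := PI_RGT_0).
  assert (ER : ex_RInt (radius h 1) (- PI / 2) (3 * PI / 2)).
  { intros; apply @ex_RInt_continuous; intros; apply continuous_radius, Hh. }
  assert (H1 : is_RInt (turning h 1) (- PI / 2) (3 * PI / 2)
    (plus (minus (critical_gauge h (3 * PI / 2)) (critical_gauge h (- PI / 2)))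
      (scal (/ (2 * h)) (RInt (radius h 1) (- PI / 2) (3 * PI / 2))))).
  { apply (is_RInt_ext (fun x => plus (turning h 1 x - radius h 1 x / (2 * h))
      (scal (/ (2 * h)) (radius h 1 x)))).
    { intros x _. unfold plus, scal; simpl; unfold mult; simpl. field. lra. }
    apply @is_RInt_plus.
    - apply (is_RInt_derive (critical_gauge h)).
      + intros; apply is_derive_critical_gauge, Hh.
      + intros x _. apply @continuous_minus; [apply continuous_turning, Hh|].
        apply (continuous_ext (fun x => scal (/ (2 * h)) (radius h 1 x))).
        { intros t. unfold scal; simpl; unfold mult; simpl. field; lra. }
        apply @continuous_scal_r, continuous_radius, Hh.
    - apply @is_RInt_scal, (@RInt_correct R_CompleteNormedModule), ER. }
  unfold total_turning. rewrite (is_RInt_unique _ _ _ _ H1).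
  rewrite radius_critical_integral by auto.
  unfold critical_gauge. rewrite cos_left_end, cos_right_end, !Rmult_0_r.
  assert (Z : forall d, atan (0 / d) = 0).
  { intros d. unfold Rdiv. rewrite Rmult_0_l. apply atan_0. }
  rewrite !Z.
  unfold alpha, minus, plus, opp, scal; simpl; unfold mult; simpl. field. lra.
Qed.

(** * Primitives of periodic functions *)

Lemma is_derive_primitive (f : R -> R) (a x : R) :
  (forall t, continuous f t) -> is_derive (fun y => RInt f a y) x (f x).
Proof.
  intros Hf. apply (is_derive_RInt f (fun y => RInt f a y) a); auto.
  apply filter_forall. intros y.
  apply (@RInt_correct R_CompleteNormedModule), @ex_RInt_continuous; auto.
Qed.

Lemma primitive_periodic (f : R -> R) (a P x : R) (k : Z) :
  (forall t, continuous f t) -> (forall t, f (t + P) = f t) ->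
  RInt f a (x + IZR k * P) = RInt f a x + IZR k * RInt f a (a + P).
Proof.
  intros Hc Hp. set (F := (fun y => RInt f a y) : R -> R).
  assert (step : forall x, F (x + P) = F x + F (a + P)).
  { intros y.
    assert (D : forall t, is_derive (fun t => F (t + P) - F t) t 0).
    { intros t.
      apply (is_derive_eq (fun t => F (t + P) - F t) _ t (1 * f (t + P) - f t)).
      - apply (is_derive_minus (fun t => F (t + P)) F t _ (f t)).
        + apply (is_derive_comp F (fun t => t + P) t (f (t + P)) 1).
          * apply is_derive_primitive; auto.
          * auto_derive; auto.
        + apply is_derive_primitive; auto.
      - reflexivity.
      - rewrite Hp; ring. }
    assert (E := zero_derive_constant _ D y a).
    assert (F a = 0) by (unfold F; apply (@RInt_point R_CompleteNormedModule)).
    lra. }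
  change (F (x + IZR k * P) = F x + IZR k * F (a + P)).
  assert (nat_case : forall n x, F (x + INR n * P) = F x + INR n * F (a + P)).
  { induction n as [|n IH]; intros y.
    - simpl. rewrite !Rmult_0_l, !Rplus_0_r. reflexivity.
    - rewrite S_INR. replace (y + (INR n + 1) * P) with (y + INR n * P + P) by ring.
      rewrite step, IH. ring. }
  destruct (Z.le_ge_cases 0 k) as [Hk|Hk].
  - rewrite <- (Z2Nat.id k), <- INR_IZR_INZ by auto. apply nat_case.
  - assert (E := nat_case (Z.to_nat (- k)) (x + IZR k * P)).
    rewrite INR_IZR_INZ, Z2Nat.id, opp_IZR in E by lia.
    replace (x + IZR k * P + - IZR k * P) with x in E by ring. lra.
Qed.

(** * The model curves *)

Lemma stretch_ge_1 (h A psi : R) : 1 <= stretch h A psi.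
Proof.
  unfold stretch. rewrite <- sqrt_1 at 1. apply sqrt_le_1_alt.
  generalize (pow2_ge_0 (height A psi / h)). lra.
Qed.

Lemma stretch_sqr (h A psi : R) : stretch h A psi ^ 2 = 1 + (height A psi / h) ^ 2.
Proof.
  apply pow2_sqrt. generalize (pow2_ge_0 (height A psi / h)). lra.
Qed.

Lemma is_derive_stretch (h A psi : R) :
  is_derive (stretch h A) psi
    (height A psi / h * (A * cos psi / h) / stretch h A psi).
Proof.
  assert (Hp := stretch_ge_1 h A psi).
  assert (Hq : 0 < 1 + (height A psi / h) ^ 2).
  { generalize (pow2_ge_0 (height A psi / h)). lra. }
  assert (Hy : is_derive (fun x => height A x / h) psi (A * cos psi / h)).
  { apply (is_derive_eq (fun x => height A x * / h) _ psi
      (A * cos psi * / h + height A psi * 0)).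
    - apply (is_derive_Rmult (height A) (fun _ => / h));
        [apply is_derive_height | apply @is_derive_const].
    - reflexivity.
    - unfold Rdiv; ring. }
  assert (D := is_derive_unique _ _ _ Hy).
  unfold stretch in *. set (y := fun x => height A x / h) in *.
  change (height A psi / h) with (y psi) in *.
  change (is_derive (fun x => sqrt (1 + y x ^ 2)) psi
    (y psi * (A * cos psi / h) / sqrt (1 + y psi ^ 2))).
  auto_derive.
  - simpl in Hq. repeat split; auto. now eexists; exact Hy.
  - replace (Derive (fun x : R => y x) psi) with (A * cos psi / h)
      by (symmetry; exact D).
    replace (1 + y psi * (y psi * 1)) with (1 + y psi ^ 2) by ring.
    unfold Rdiv. set (c := A * cos psi * / h). field. lra.
Qed.

Lemma continuous_stretch (h A psi : R) : continuous (stretch h A) psi.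
Proof. exact (continuous_of_is_derive _ _ _ (is_derive_stretch h A psi)). Qed.

Definition arclength (h A psi : R) : R := RInt (stretch h A) (- PI / 2) psi.

Definition tangent_angle (h A psi : R) : R := RInt (turning h A) (- PI / 2) psi.

Definition period_length (h A : R) : R := arclength h A (3 * PI / 2).

Lemma is_derive_arclength (h A psi : R) :
  is_derive (arclength h A) psi (stretch h A psi).
Proof. apply is_derive_primitive. intros; apply continuous_stretch. Qed.

Lemma is_derive_tangent_angle (h A psi : R) :
  0 < h -> is_derive (tangent_angle h A) psi (turning h A psi).
Proof. intros. apply is_derive_primitive. intros; apply continuous_turning; auto. Qed.

Lemma arclength_expanding (h A x y : R) :
  x <= y -> y - x <= arclength h A y - arclength h A x.
Proof.
  intros Hxy.
  destruct (MVT_gen (arclength h A) x y (stretch h A)) as [c [_ Hc]].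
  - intros; apply is_derive_arclength.
  - intros z _. apply continuity_pt_filterlim.
    exact (continuous_of_is_derive _ _ _ (is_derive_arclength h A z)).
  - rewrite Hc. generalize (stretch_ge_1 h A c). nra.
Qed.

Lemma arclength_injective (h A x y : R) : arclength h A x = arclength h A y -> x = y.
Proof.
  intros E. destruct (Rle_or_lt x y) as [L|L].
  - generalize (arclength_expanding h A x y L); lra.
  - generalize (arclength_expanding h A y x); lra.
Qed.

Lemma arclength_surjective (h A s : R) : {psi | arclength h A psi = s}.
Proof.
  set (a := - PI / 2 - Rabs s). set (b := - PI / 2 + Rabs s).
  assert (Hs := Rabs_pos s).
  assert (H0 : arclength h A (- PI / 2) = 0) by apply (@RInt_point R_CompleteNormedModule).
  assert (Ha := arclength_expanding h A a (- PI / 2) ltac:(unfold a; lra)).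
  assert (Hb := arclength_expanding h A (- PI / 2) b ltac:(unfold b; lra)).
  assert (Hs2 := Rle_abs s). assert (Hs3 := Rle_abs (- s)). rewrite Rabs_Ropp in Hs3.
  destruct (IVT_gen (arclength h A) a b s) as [psi [_ H]].
  - intros z. apply continuity_pt_filterlim.
    exact (continuous_of_is_derive _ _ _ (is_derive_arclength h A z)).
  - rewrite Rmin_left, Rmax_right by (unfold a, b in *; lra). unfold a, b in *; lra.
  - now exists psi.
Qed.

Definition phase (h A s : R) : R := proj1_sig (arclength_surjective h A s).

Lemma arclength_phase (h A s : R) : arclength h A (phase h A s) = s.
Proof. exact (proj2_sig (arclength_surjective h A s)). Qed.

Lemma phase_arclength (h A psi : R) : phase h A (arclength h A psi) = psi.
Proof. apply (arclength_injective h A). apply arclength_phase. Qed.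

(** [arclength] expands distances, so the difference quotients of its inverse
    stay in [[0, 1]] and converge to the inverse of its derivative. *)
Lemma is_derive_phase (h A s : R) :
  is_derive (phase h A) s (/ stretch h A (phase h A s)).
Proof.
  apply is_derive_Reals. intros eps Heps.
  assert (HF := is_derive_arclength h A (phase h A s)).
  apply is_derive_Reals in HF. destruct (HF eps Heps) as [d Hd].
  exists d. intros t Ht Htd.
  set (k := phase h A (s + t) - phase h A s).
  assert (Ek : arclength h A (phase h A s + k) - arclength h A (phase h A s) = t).
  { unfold k. replace (phase h A s + (phase h A (s + t) - phase h A s))
      with (phase h A (s + t)) by ring. rewrite !arclength_phase. ring. }
  assert (Hk0 : k <> 0).
  { intros E. rewrite E, Rplus_0_r in Ek. lra. }
  assert (Hkt : 1 <= t / k /\ Rabs k <= Rabs t).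
  { destruct (Rle_or_lt 0 k) as [L|L].
    - assert (E := arclength_expanding h A (phase h A s) (phase h A s + k) ltac:(lra)).
      split.
      + apply (Rmult_le_reg_r k); [lra|]. unfold Rdiv. rewrite Rmult_assoc, Rinv_l; lra.
      + rewrite !Rabs_pos_eq; lra.
    - assert (E := arclength_expanding h A (phase h A s + k) (phase h A s) ltac:(lra)).
      split.
      + replace (t / k) with (- t / - k) by (field; lra).
        apply (Rmult_le_reg_r (- k)); [lra|]. unfold Rdiv. rewrite Rmult_assoc, Rinv_l; lra.
      + rewrite !Rabs_left; lra. }
  destruct Hkt as [Hq Hkt].
  assert (Hst := stretch_ge_1 h A (phase h A s)).
  specialize (Hd k Hk0 ltac:(lra)). rewrite Ek in Hd.
  set (q := t / k) in *. set (l := stretch h A (phase h A s)) in *.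
  assert (E : (phase h A (s + t) - phase h A s) / t = / q).
  { fold k. unfold q. field. auto. }
  fold k in E |- *. rewrite E.
  replace (/ q - / l) with (- (q - l) * / (q * l)) by (field; lra).
  rewrite Rabs_mult, Rabs_Ropp.
  apply Rle_lt_trans with (2 := Hd).
  rewrite <- (Rmult_1_r (Rabs (q - l))) at 2.
  apply Rmult_le_compat_l; [apply Rabs_pos|].
  assert (1 <= q * l) by nra.
  rewrite Rabs_pos_eq; [|apply Rlt_le, Rinv_0_lt_compat; lra].
  rewrite <- Rinv_1. apply Rinv_le_contravar; lra.
Qed.

(** The coordinates [(tau, nu)] of the curve in its moving frame. *)
Definition frame_position (h A psi : R) : C :=
  (- A * cos psi / stretch h A psi,
   height A psi / h * radius h A psi / stretch h A psi).

Definition profile (h A s : R) : C :=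
  (cis (tangent_angle h A (phase h A s)) * frame_position h A (phase h A s))%C.

Definition profile_tangent (h A s : R) : C := cis (tangent_angle h A (phase h A s)).

Lemma turning_alt (h A psi : R) :
  0 < h ->
  turning h A psi = radius h A psi / (h * stretch h A psi ^ 2)
    - height A psi / h / radius h A psi.
Proof.
  intros Hh. assert (Hp := radius_pos h A psi Hh).
  assert (Hq := height_denominator_pos h A psi Hh).
  unfold turning. rewrite stretch_sqr. field. split; [lra|].
  split; [|lra].
  apply Rgt_not_eq. simpl in *. lra.
Qed.

Lemma radius_stretch_sqr (h A psi : R) :
  0 < h -> radius h A psi ^ 2 = h ^ 2 * stretch h A psi ^ 2 + (A * cos psi) ^ 2.
Proof.
  intros Hh. rewrite radius_sqr, stretch_sqr, radicand_decomposition by auto.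
  field. lra.
Qed.

(** This is the moving frame system in the phase parameter: it makes [profile] a curve
    with unit tangent [profile_tangent]. *)
Lemma is_derive_frame_position (h A psi : R) :
  0 < h ->
  has_cderive (frame_position h A) psi
    (RtoC (stretch h A psi) - RtoC (turning h A psi) * (Ci * frame_position h A psi))%C.
Proof.
  intros Hh.
  assert (Hr := is_derive_radius h A psi Hh). assert (Hp := radius_pos h A psi Hh).
  assert (Hst := is_derive_stretch h A psi). assert (Hs1 := stretch_ge_1 h A psi).
  assert (HV := is_derive_height A psi).
  assert (E1 := stretch_sqr h A psi). assert (E2 := radius_stretch_sqr h A psi Hh).
  assert (HQ : A * sin psi = h * (height A psi / h) + 1) by (unfold height; field; lra).
  assert (DR := is_derive_unique _ _ _ Hr). assert (DS := is_derive_unique _ _ _ Hst).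
  assert (DV := is_derive_unique _ _ _ HV).
  assert (EV : height A psi = h * (height A psi / h)) by (field; lra).
  assert (Htu := turning_alt h A psi Hh).
  unfold frame_position, has_cderive. simpl. rewrite Htu.
  set (r := radius h A) in *. set (st := stretch h A) in *. set (V := height A) in *.
  split.
  - auto_derive.
    + repeat split; try (eexists; eassumption); lra.
    + replace (Derive (fun x : R => st x) psi) with (V psi / h * (A * cos psi / h) / st psi)
        by (symmetry; exact DS).
      set (y := V psi / h) in *.
      transitivity ((h * y + 1) / st psi + (A * cos psi) ^ 2 * y / (h * st psi ^ 3)).
      { rewrite <- HQ. field. lra. }
      set (P := A * cos psi) in *.
      field_simplify_eq; [|lra].
      ring [E1 E2].
  - auto_derive.
    + repeat split; try (eexists; eassumption); lra.
    + replace (Derive (fun x : R => st x) psi) with (V psi / h * (A * cos psi / h) / st psi)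
        by (symmetry; exact DS).
      replace (Derive (fun x : R => r x) psi) with (- A * cos psi / r psi)
        by (symmetry; exact DR).
      replace (Derive (fun x : R => V x) psi) with (A * cos psi)
        by (symmetry; exact DV).
      rewrite EV. set (y := V psi / h) in *.
      field_simplify_eq; [|lra].
      ring [E1 E2].
Qed.

Lemma has_cderive_comp (X : R -> C) (f : R -> R) (s l : R) (v : C) :
  has_cderive X (f s) v -> is_derive f s l ->
  has_cderive (fun u => X (f u)) s (RtoC l * v)%C.
Proof.
  intros [H1 H2] Hf. split.
  - apply (is_derive_eq _ _ _ _ _ (is_derive_comp (fun u => Re (X u)) f s _ _ H1 Hf)).
    + reflexivity.
    + unfold scal; simpl; unfold mult, Re; simpl. ring.
  - apply (is_derive_eq _ _ _ _ _ (is_derive_comp (fun u => Im (X u)) f s _ _ H2 Hf)).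
    + reflexivity.
    + unfold scal; simpl; unfold mult, Im; simpl. ring.
Qed.

Definition profile_curvature (h A psi : R) : R := turning h A psi / stretch h A psi.

Lemma is_derive_profile_angle (h A s : R) :
  0 < h ->
  is_derive (fun s => tangent_angle h A (phase h A s)) s
    (profile_curvature h A (phase h A s)).
Proof.
  intros Hh.
  apply (is_derive_eq _ _ _ _ _ (is_derive_comp (tangent_angle h A) (phase h A) s _ _
    (is_derive_tangent_angle h A _ Hh) (is_derive_phase h A s))).
  - reflexivity.
  - unfold scal; simpl; unfold mult, profile_curvature, Rdiv; simpl. ring.
Qed.

Lemma has_cderive_profile_tangent (h A s : R) :
  0 < h ->
  has_cderive (profile_tangent h A) s
    (RtoC (profile_curvature h A (phase h A s)) * (Ci * profile_tangent h A s))%C.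
Proof.
  intros Hh. apply (has_cderive_cis (fun s => tangent_angle h A (phase h A s))).
  apply is_derive_profile_angle, Hh.
Qed.

Lemma has_cderive_profile (h A s : R) :
  0 < h -> has_cderive (profile h A) s (profile_tangent h A s).
Proof.
  intros Hh.
  assert (H := has_cderive_mult _ _ _ _ _ (has_cderive_profile_tangent h A s Hh)
    (has_cderive_comp _ _ _ _ _ (is_derive_frame_position h A (phase h A s) Hh)
      (is_derive_phase h A s))).
  replace (profile_tangent h A s) with
    (profile_curvature h A (phase h A s) * (Ci * profile_tangent h A s)
     * frame_position h A (phase h A s)
     + profile_tangent h A s * (RtoC (/ stretch h A (phase h A s))
      * (stretch h A (phase h A s)
         - turning h A (phase h A s) * (Ci * frame_position h A (phase h A s)))))%C.
  - exact H.
  - assert (Hs := stretch_ge_1 h A (phase h A s)).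
    unfold profile_curvature.
    apply injective_projections; simpl; field; lra.
Qed.

Lemma Cmod_profile_tangent (h A s : R) : Cmod (profile_tangent h A s) = 1.
Proof. apply Cmod_cis. Qed.

Lemma frame_coordinates (z T : C) :
  Cmod T = 1 -> dotC (T * z)%C T = Re z /\ dotC (T * z)%C (Ci * T)%C = Im z.
Proof.
  intros H. split.
  - transitivity (dotC (T * z)%C (T * RtoC 1)%C); [now rewrite Cmult_1_r|].
    rewrite dotC_rotate by auto. unfold dotC; simpl; ring.
  - rewrite (Cmult_comm Ci), dotC_rotate by auto. unfold dotC; simpl; ring.
Qed.

Lemma frame_position_norms (h A psi : R) :
  0 < h ->
  let z := frame_position h A psi in
  Re z ^ 2 + h ^ 2 = (radius h A psi / stretch h A psi) ^ 2 /\
  Re z ^ 2 + Im z ^ 2 + h ^ 2 = radius h A psi ^ 2.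
Proof.
  intros Hh z. assert (Hs1 := stretch_ge_1 h A psi).
  assert (E1 := stretch_sqr h A psi). assert (E2 := radius_stretch_sqr h A psi Hh).
  unfold z, frame_position; simpl Re; simpl Im.
  assert (H : (- A * cos psi / stretch h A psi) ^ 2 + h ^ 2
     = (radius h A psi / stretch h A psi) ^ 2).
  { unfold Rdiv. rewrite !Rpow_mult_distr, E2. field. lra. }
  split; [exact H|].
  transitivity ((radius h A psi / stretch h A psi) ^ 2
    + (height A psi / h * radius h A psi / stretch h A psi) ^ 2); [rewrite <- H; ring|].
  transitivity (radius h A psi ^ 2 * (1 + (height A psi / h) ^ 2) / stretch h A psi ^ 2).
  - field. lra.
  - rewrite <- E1. field. lra.
Qed.

Lemma profile_generates_CMC (h A : R) : 0 < h -> generates_CMC h 1 (profile h A).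
Proof.
  intros Hh s t.
  rewrite (helicoidal_mean_curvature h (profile h A) (profile_tangent h A)
    (profile_curvature h A (phase h A s))); auto.
  2: intros; apply has_cderive_profile; auto.
  2: intros; apply Cmod_profile_tangent.
  2: apply has_cderive_profile_tangent; auto.
  set (psi := phase h A s).
  destruct (frame_coordinates (frame_position h A psi) (profile_tangent h A s)
    (Cmod_profile_tangent h A s)) as [E1 E2].
  change (profile_tangent h A s * frame_position h A psi)%C with (profile h A s) in E1, E2.
  destruct (frame_position_norms h A psi Hh) as [N1 N2].
  rewrite E1, E2, N1, N2.
  assert (Hp := radius_pos h A psi Hh). assert (Hs1 := stretch_ge_1 h A psi).
  rewrite sqrt_pow2 by (apply Rlt_le, Rdiv_lt_0_compat; lra).
  unfold profile_curvature. rewrite turning_alt by auto.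
  simpl Im. field. lra.
Qed.

(** * Smoothness *)

Inductive generated (G : (R -> R) -> Prop) : (R -> R) -> Prop :=
| generated_generator f : G f -> generated G f
| generated_const c : generated G (fun _ => c)
| generated_plus f g : generated G f -> generated G g -> generated G (fun x => f x + g x)
| generated_mult f g : generated G f -> generated G g -> generated G (fun x => f x * g x).

(** An algebra of functions is stable under differentiation as soon as it
    contains the derivatives of its generators; its elements are then smooth. *)
Lemma generated_smooth (G : (R -> R) -> Prop) :
  (forall f, G f -> exists g, generated G g /\ forall x, is_derive f x (g x)) ->
  forall f, generated G f -> forall n x, ex_derive_n f n x.
Proof.
  intros HG.
  assert (step : forall f, generated G f ->
    exists g, generated G g /\ forall x, is_derive f x (g x)).
  { intros f Hf. induction Hf as [f Hf|c|f g _ [f' [Gf Df]] Cg [g' [Gg Dg]]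
      |f g Cf [f' [Gf Df]] Cg [g' [Gg Dg]]].
    - auto.
    - exists (fun _ => 0). split; [apply generated_const|]. intros; apply @is_derive_const.
    - exists (fun x => f' x + g' x). split; [now apply generated_plus|].
      intros x. exact (is_derive_plus _ _ _ _ _ (Df x) (Dg x)).
    - exists (fun x => f' x * g x + f x * g' x).
      split; [now apply generated_plus; apply generated_mult|].
      intros x. apply is_derive_Rmult; auto. }
  assert (higher : forall n f, generated G f ->
    exists g, generated G g /\ forall x, Derive_n f n x = g x).
  { induction n as [|n IH]; intros f Hf.
    - now exists f.
    - destruct (IH f Hf) as [g [Gg Eg]]. destruct (step g Gg) as [g' [Gg' Dg]].
      exists g'. split; auto. intros x. simpl.
      rewrite (Derive_ext _ g); auto. now apply is_derive_unique. }
  intros f Hf [|n] x; simpl; auto.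
  destruct (higher n f Hf) as [g [Gg Eg]]. destruct (step g Gg) as [g' [_ Dg]].
  exists (g' x). apply (is_derive_eq g _ x (g' x)); auto.
Qed.

(** The reciprocals of [stretch] and [radius] suffice, because the squares of these
    functions are polynomials in the sine of the phase. *)
Inductive profile_generator (h A : R) : (R -> R) -> Prop :=
| gen_sin : profile_generator h A (fun s => sin (phase h A s))
| gen_cos : profile_generator h A (fun s => cos (phase h A s))
| gen_stretch : profile_generator h A (fun s => / stretch h A (phase h A s))
| gen_radius : profile_generator h A (fun s => / radius h A (phase h A s))
| gen_angle_sin : profile_generator h A (fun s => sin (tangent_angle h A (phase h A s)))
| gen_angle_cos : profile_generator h A (fun s => cos (tangent_angle h A (phase h A s))).

Ltac prove_generated :=
  repeat first [ apply generated_const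
    | apply generated_generator; constructor
    | apply generated_plus | apply generated_mult ].

Lemma is_derive_along_phase (f : R -> R) (h A s l : R) :
  is_derive f (phase h A s) l ->
  is_derive (fun s => f (phase h A s)) s (l * / stretch h A (phase h A s)).
Proof.
  intros H. apply (is_derive_eq _ _ _ _ _ (is_derive_comp f (phase h A) s _ _ H
    (is_derive_phase h A s))); [reflexivity|].
  unfold scal; simpl; unfold mult; simpl. ring.
Qed.

Lemma profile_generators_closed (h A : R) (f : R -> R) :
  0 < h -> profile_generator h A f ->
  exists g, generated (profile_generator h A) g /\ forall x, is_derive f x (g x).
Proof.
  intros Hh Hf.
  assert (Hst : forall x, stretch h A x <> 0)
    by (intros x; generalize (stretch_ge_1 h A x); lra).
  assert (Hra : forall x, radius h A x <> 0)
    by (intros x; generalize (radius_pos h A x Hh); lra).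
  set (k := fun s => ((h * h + 1 + A * A + -2 * A * sin (phase h A s))
        * / radius h A (phase h A s) * / stretch h A (phase h A s)
        * / stretch h A (phase h A s) * / h
       + -1 * / h * (A * sin (phase h A s) + -1) * / radius h A (phase h A s))
      * / stretch h A (phase h A s)).
  assert (Hk : forall s, profile_curvature h A (phase h A s) = k s).
  { intros s. unfold profile_curvature, k. rewrite turning_alt by auto.
    replace (h * h + 1 + A * A + -2 * A * sin (phase h A s))
      with (radius h A (phase h A s) ^ 2) by (rewrite radius_sqr by auto; ring).
    unfold height. field. auto with real. }
  assert (Gk : generated (profile_generator h A) k) by (unfold k; prove_generated).
  destruct Hf.
  - exists (fun s => cos (phase h A s) * / stretch h A (phase h A s)).
    split; [prove_generated|].
    intros s. apply is_derive_along_phase, is_derive_sin.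
  - exists (fun s => -1 * sin (phase h A s) * / stretch h A (phase h A s)).
    split; [prove_generated|].
    intros s. apply is_derive_along_phase.
    replace (-1 * sin (phase h A s)) with (- sin (phase h A s)) by ring.
    apply is_derive_cos.
  - exists (fun s => -1 * / h * / h * (A * sin (phase h A s) + -1) * A * cos (phase h A s)
      * / stretch h A (phase h A s) * / stretch h A (phase h A s)
      * / stretch h A (phase h A s) * / stretch h A (phase h A s)).
    split; [prove_generated|].
    intros s. apply (is_derive_along_phase (fun x => / stretch h A x)).
    apply (is_derive_eq (fun x => / stretch h A x) _ _ _ _ (is_derive_inv _ _ _ (is_derive_stretch h A _) (Hst _)));
      [reflexivity|].
    unfold height. field. auto with real.
  - exists (fun s => A * cos (phase h A s) * / radius h A (phase h A s)
      * / radius h A (phase h A s) * / radius h A (phase h A s)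
      * / stretch h A (phase h A s)).
    split; [prove_generated|].
    intros s. apply (is_derive_along_phase (fun x => / radius h A x)).
    apply (is_derive_eq (fun x => / radius h A x) _ _ _ _ (is_derive_inv _ _ _ (is_derive_radius h A _ Hh) (Hra _)));
      [reflexivity|].
    field. auto with real.
  - exists (fun s => k s * cos (tangent_angle h A (phase h A s))).
    split; [apply generated_mult; [exact Gk | prove_generated]|].
    intros s. apply (is_derive_eq _ _ _ _ _ (proj2 (has_cderive_profile_tangent h A s Hh)));
      [reflexivity|].
    rewrite <- Hk. simpl. ring.
  - exists (fun s => -1 * k s * sin (tangent_angle h A (phase h A s))).
    split; [repeat apply generated_mult; first [exact Gk | prove_generated]|].
    intros s. apply (is_derive_eq _ _ _ _ _ (proj1 (has_cderive_profile_tangent h A s Hh)));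
      [reflexivity|].
    rewrite <- Hk. simpl. ring.
Qed.

Lemma profile_smooth (h A : R) : 0 < h -> smooth_curve (profile h A).
Proof.
  intros Hh n s.
  assert (sm := generated_smooth (profile_generator h A)
    (fun f => profile_generators_closed h A f Hh)).
  set (a := fun s => -1 * A * cos (phase h A s) * / stretch h A (phase h A s)).
  set (b := fun s => / h * (A * sin (phase h A s) + -1)
    * (h * h + 1 + A * A + -2 * A * sin (phase h A s))
    * / radius h A (phase h A s) * / stretch h A (phase h A s)).
  assert (Hab : forall s, frame_position h A (phase h A s) = (a s, b s)).
  { intros t. assert (Hp := radius_pos h A (phase h A t) Hh).
    assert (Hs1 := stretch_ge_1 h A (phase h A t)).
    unfold frame_position, a, b, height.
    replace (h * h + 1 + A * A + -2 * A * sin (phase h A t))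
      with (radius h A (phase h A t) ^ 2) by (rewrite radius_sqr by auto; ring).
    f_equal; field; lra. }
  split.
  - apply (ex_derive_n_ext (fun s => cos (tangent_angle h A (phase h A s)) * a s
      + -1 * sin (tangent_angle h A (phase h A s)) * b s)).
    { intros t. unfold profile. rewrite Hab. simpl. ring. }
    apply sm. unfold a, b. prove_generated.
  - apply (ex_derive_n_ext (fun s => cos (tangent_angle h A (phase h A s)) * b s
      + sin (tangent_angle h A (phase h A s)) * a s)).
    { intros t. unfold profile. rewrite Hab. simpl. ring. }
    apply sm. unfold a, b. prove_generated.
Qed.

(** * Periods and symmetries of the model curves *)

Lemma stretch_periodic (h A psi : R) : stretch h A (psi + 2 * PI) = stretch h A psi.
Proof.
  unfold stretch, height. replace (2 * PI) with (2 * INR 1 * PI) by (simpl; ring).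
  now rewrite sin_period.
Qed.

Lemma turning_periodic (h A psi : R) : turning h A (psi + 2 * PI) = turning h A psi.
Proof.
  unfold turning, radius, height. replace (2 * PI) with (2 * INR 1 * PI) by (simpl; ring).
  now rewrite sin_period.
Qed.

Lemma arclength_period (h A psi : R) (k : Z) :
  arclength h A (psi + IZR k * (2 * PI)) = arclength h A psi + IZR k * period_length h A.
Proof.
  unfold period_length, arclength.
  rewrite primitive_periodic.
  - do 2 f_equal. f_equal. field.
  - intros; apply continuous_stretch.
  - apply stretch_periodic.
Qed.

Lemma tangent_angle_period (h A psi : R) (k : Z) :
  0 < h ->
  tangent_angle h A (psi + IZR k * (2 * PI))
  = tangent_angle h A psi + IZR k * total_turning h A.
Proof.
  intros Hh. unfold total_turning, tangent_angle.
  rewrite primitive_periodic.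
  - do 2 f_equal. f_equal. field.
  - intros; apply continuous_turning, Hh.
  - apply turning_periodic.
Qed.

Lemma period_length_pos (h A : R) : 0 < period_length h A.
Proof.
  assert (H := arclength_expanding h A (- PI / 2) (3 * PI / 2)).
  assert (H0 : arclength h A (- PI / 2) = 0) by apply (@RInt_point R_CompleteNormedModule).
  generalize PI_RGT_0; unfold period_length; lra.
Qed.

Lemma phase_period (h A s : R) (k : Z) :
  phase h A (s + IZR k * period_length h A) = phase h A s + IZR k * (2 * PI).
Proof.
  apply (arclength_injective h A).
  now rewrite arclength_period, !arclength_phase.
Qed.

Lemma frame_position_periodic (h A psi : R) (k : Z) :
  frame_position h A (psi + IZR k * (2 * PI)) = frame_position h A psi.
Proof.
  replace (psi + IZR k * (2 * PI)) with (psi + 2 * PI * IZR k) by ring.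
  assert (H := cis_period psi k). injection H as Hc Hs.
  unfold frame_position, stretch, radius, height. now rewrite Hc, Hs.
Qed.

Lemma profile_period (h A s : R) (k : Z) :
  0 < h ->
  profile h A (s + IZR k * period_length h A)
  = (cis (IZR k * total_turning h A) * profile h A s)%C.
Proof.
  intros Hh. unfold profile.
  rewrite phase_period, tangent_angle_period, frame_position_periodic, Rplus_comm, cis_plus
    by auto.
  ring.
Qed.

Lemma cancel_unit (T v w : C) : Cmod T = 1 -> (T * v)%C = (T * w)%C -> v = w.
Proof.
  intros H E.
  destruct (frame_coordinates v T H) as [E1 E2].
  destruct (frame_coordinates w T H) as [E3 E4].
  apply injective_projections.
  - change (Re v = Re w). now rewrite <- E1, <- E3, E.
  - change (Im v = Im w). now rewrite <- E2, <- E4, E.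
Qed.

(** The first coordinate determines [sqrt (tau^2 + h^2)], the second one then determines
    [height], hence the sine, and the first one determines the cosine. *)
Lemma frame_position_phase (h A x y : R) :
  0 < h -> 0 < A -> frame_position h A x = frame_position h A y -> cis x = cis y.
Proof.
  intros Hh HA E.
  destruct (frame_position_norms h A x Hh) as [Nx _].
  destruct (frame_position_norms h A y Hh) as [Ny _].
  assert (Hx := stretch_ge_1 h A x). assert (Hy := stretch_ge_1 h A y).
  assert (Rx := radius_pos h A x Hh). assert (Ry := radius_pos h A y Hh).
  rewrite E, Ny in Nx.
  assert (Wx : 0 < radius h A x / stretch h A x) by (apply Rdiv_lt_0_compat; lra).
  assert (Wy : 0 < radius h A y / stretch h A y) by (apply Rdiv_lt_0_compat; lra).
  assert (W : radius h A x / stretch h A x = radius h A y / stretch h A y).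
  { apply Rsqr_inj; [lra | lra |]. unfold Rsqr. lra. }
  injection E as E1 E2.
  assert (HV : height A x = height A y).
  { apply (Rmult_eq_reg_r (radius h A y / stretch h A y / h)).
    2: apply Rgt_not_eq, Rdiv_lt_0_compat; auto.
    rewrite <- W at 1.
    transitivity (height A x / h * radius h A x / stretch h A x); [field; lra|].
    rewrite E2. field. lra. }
  assert (HS : stretch h A x = stretch h A y) by (unfold stretch; now rewrite HV).
  unfold height in HV. rewrite HS in E1. unfold cis. f_equal.
  - apply (Rmult_eq_reg_l (- A / stretch h A y)).
    2:{ apply Rlt_not_eq. unfold Rdiv.
        assert (0 < / stretch h A y) by (apply Rinv_0_lt_compat; lra). nra. }
    transitivity (- A * cos x / stretch h A y); [field; lra|].
    rewrite E1. field. lra.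
  - apply (Rmult_eq_reg_l A); lra.
Qed.

(** The moving frame coordinates of a curve are invariant under its symmetries, and
    for [0 < A] they determine the phase modulo [2 PI]. *)
Lemma profile_symmetries (h A c : R) (z : C) :
  0 < h -> 0 < A -> Cmod z = 1 ->
  (forall s, (z * profile h A s)%C = profile h A (s + c)) ->
  exists k : Z, c = IZR k * period_length h A /\ z = cis (IZR k * total_turning h A).
Proof.
  intros Hh HA Hz H.
  assert (HT : forall s, (z * profile_tangent h A s)%C = profile_tangent h A (s + c)).
  { intros s.
    assert (D1 := has_cderive_shift _ s c _ (has_cderive_profile h A (s + c) Hh)).
    assert (D2 : has_cderive (fun u => profile h A (u + c)) s (z * profile_tangent h A s)%C).
    { rewrite <- (Rplus_0_r s) at 2.
      apply (CDerive_rotate_shift z (profile h A) _ 0 s).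
      - intros u. now rewrite Rplus_0_r.
      - apply has_cderive_profile, Hh. }
    now rewrite <- (CDerive_unique _ _ _ D1), <- (CDerive_unique _ _ _ D2). }
  assert (Hf : frame_position h A (phase h A (0 + c)) = frame_position h A (phase h A 0)).
  { apply (cancel_unit (profile_tangent h A (0 + c))); [apply Cmod_profile_tangent|].
    transitivity (profile h A (0 + c)); [reflexivity|].
    rewrite <- H, <- HT. unfold profile, profile_tangent. ring. }
  destruct (cis_eq _ _ (frame_position_phase _ _ _ _ Hh HA Hf)) as [k Hk].
  rewrite Rplus_0_l in Hk.
  assert (Hc : c = IZR k * period_length h A).
  { rewrite <- (arclength_phase h A c), Hk.
    replace (phase h A 0 + 2 * PI * IZR k) with (phase h A 0 + IZR k * (2 * PI)) by ring.
    rewrite arclength_period, arclength_phase. ring. }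
  exists k. split; [exact Hc|].
  assert (E := HT 0). unfold profile_tangent in E.
  rewrite Hc, phase_period, tangent_angle_period, Rplus_comm, cis_plus in E by auto.
  apply (cancel_unit (profile_tangent h A 0)); [apply Cmod_profile_tangent|].
  unfold profile_tangent. now rewrite Cmult_comm, E, Cmult_comm.
Qed.

(** * Classification *)

(** The first integral behind the classification: [u = h y + 1] and [v = - tau rho]
    satisfy [u' = v / rho] and [v' = - u / rho]. The amplitude of this rotation is the
    parameter [A], its angle is the phase. *)
Lemma frame_system_solutions (h : R) (tau nu k : R -> R) :
  0 < h ->
  (forall s, is_derive tau s (1 + k s * nu s)) ->
  (forall s, is_derive nu s (- (k s * tau s))) ->
  (forall s, h * (k s * (tau s ^ 2 + nu s ^ 2 + h ^ 2) + nu s)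
             = sqrt (tau s ^ 2 + h ^ 2) ^ 3) ->
  exists A c : R, 0 <= A /\ forall s,
    (tau s, nu s) = frame_position h A (phase h A (s + c)) /\
    k s = profile_curvature h A (phase h A (s + c)).
Proof.
  intros Hh Dtau Dnu HC.
  set (w := fun s => sqrt (tau s ^ 2 + h ^ 2)).
  set (y := fun s => nu s / w s).
  set (rho := fun s => sqrt (1 + y s ^ 2)).
  set (u := fun s => h * y s + 1).
  set (v := fun s => - (tau s * rho s)).
  assert (Wq : forall s, 0 < tau s ^ 2 + h ^ 2).
  { intros s. generalize (pow2_ge_0 (tau s)); nra. }
  assert (Wp : forall s, 0 < w s) by (intros s; apply sqrt_lt_R0, Wq).
  assert (W2 : forall s, w s ^ 2 = tau s ^ 2 + h ^ 2).
  { intros s. apply pow2_sqrt, Rlt_le, Wq. }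
  assert (Rq : forall s, 0 < 1 + y s ^ 2).
  { intros s. generalize (pow2_ge_0 (y s)); lra. }
  assert (Rp : forall s, 0 < rho s) by (intros s; apply sqrt_lt_R0, Rq).
  assert (R2 : forall s, rho s ^ 2 = 1 + y s ^ 2).
  { intros s. apply pow2_sqrt, Rlt_le, Rq. }
  assert (Hnu : forall s, nu s = y s * w s).
  { intros s. unfold y. field. generalize (Wp s); lra. }
  assert (HK : forall s, k s * (rho s ^ 2 * w s ^ 2) = w s ^ 3 / h - y s * w s).
  { intros s. assert (E := HC s). fold (w s) in E. rewrite <- E, <- Hnu.
    rewrite R2.
    replace ((1 + y s ^ 2) * w s ^ 2) with (w s ^ 2 + (y s * w s) ^ 2) by ring.
    rewrite <- Hnu, W2. field. lra. }
  assert (Dw : forall s, is_derive w s (tau s * (1 + k s * nu s) / w s)).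
  { intros s. assert (D := is_derive_unique _ _ _ (Dtau s)).
    generalize (Wp s) (Wq s); unfold w; intros. auto_derive.
    - split; [now eexists|]. simpl in *; lra.
    - replace (Derive (fun x : R => tau x) s) with (1 + k s * nu s) by (symmetry; exact D).
      replace (tau s * (tau s * 1) + h * (h * 1)) with (tau s ^ 2 + h ^ 2) by ring.
      field. lra. }
  assert (Dy : forall s, is_derive y s (- tau s / h)).
  { intros s. assert (D1 := is_derive_unique _ _ _ (Dnu s)).
    assert (D2 := is_derive_unique _ _ _ (Dw s)).
    assert (Hw := Wp s). assert (HE := W2 s). assert (E := HK s). rewrite R2 in E.
    unfold y. auto_derive.
    - repeat split; try (now eexists); lra.
    - replace (Derive (fun x : R => nu x) s) with (- (k s * tau s)) by (symmetry; exact D1).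
      replace (Derive (fun x : R => w x) s) with (tau s * (1 + k s * nu s) / w s)
        by (symmetry; exact D2).
      transitivity (- tau s * (k s * ((1 + y s ^ 2) * w s ^ 2) + y s * w s) / w s ^ 3).
      + rewrite Hnu.
        replace (k s * ((1 + y s ^ 2) * w s ^ 2))
          with (k s * (w s ^ 2 + (y s * w s) ^ 2)) by ring.
        field_simplify_eq; [|lra]. ring.
      + rewrite E. field. lra. }
  assert (Drho : forall s, is_derive rho s (y s * (- tau s / h) / rho s)).
  { intros s. assert (D := is_derive_unique _ _ _ (Dy s)).
    generalize (Rp s) (Rq s); unfold rho; intros. auto_derive.
    - split; [now eexists; apply Dy|]. simpl in *; lra.
    - replace (Derive (fun x : R => y x) s) with (- tau s / h) by (symmetry; exact D).
      replace (1 + y s * (y s * 1)) with (1 + y s ^ 2) by ring.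
      set (q := sqrt (1 + y s ^ 2)) in *. field. lra. }
  assert (Du : forall s, is_derive u s (v s * / rho s)).
  { intros s. apply (is_derive_eq (fun s => h * y s + 1) _ _ (h * (- tau s / h) + 0)).
    - apply @is_derive_plus; [|apply @is_derive_const].
      apply (is_derive_scal y s h _ (Dy s)).
    - reflexivity.
    - unfold v. field. generalize (Rp s); lra. }
  assert (Dv : forall s, is_derive v s (- (u s * / rho s))).
  { intros s. apply (is_derive_eq (fun s => - (tau s * rho s)) _ _
      (- ((1 + k s * nu s) * rho s + tau s * (y s * (- tau s / h) / rho s)))).
    - apply (is_derive_opp (fun s => tau s * rho s)), is_derive_Rmult; auto.
    - reflexivity.
    - assert (Hr := Rp s). assert (Hw := Wp s). assert (E := HK s).
      assert (Hkn : k s * nu s * rho s ^ 2 = y s * w s ^ 2 / h - y s ^ 2).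
      { rewrite Hnu. apply (Rmult_eq_reg_r (w s)); [|lra].
        transitivity (y s * (k s * (rho s ^ 2 * w s ^ 2))); [ring|].
        rewrite E. field. lra. }
      transitivity (- ((rho s ^ 2 + k s * nu s * rho s ^ 2 - tau s ^ 2 * y s / h) / rho s)).
      { field. lra. }
      rewrite Hkn, R2, W2. unfold u. field. lra. }
  set (A := sqrt (u 0 ^ 2 + v 0 ^ 2)).
  assert (HA : 0 <= A) by apply sqrt_pos.
  destruct (polar_vector A (u 0) (v 0) HA) as [t0 [Hu0 Hv0]].
  { unfold A. rewrite pow2_sqrt; [reflexivity|].
    generalize (pow2_ge_0 (u 0)) (pow2_ge_0 (v 0)); lra. }
  assert (Crho : forall s, continuous (fun s => / rho s) s).
  { intros s. apply @ex_derive_continuous. auto_derive.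
    split; [eexists; apply Drho|]. generalize (Rp s); lra. }
  set (psi := (fun s => t0 + RInt (fun s => / rho s) 0 s) : R -> R).
  assert (Dpsi : forall s, is_derive psi s (/ rho s)).
  { intros s. apply (is_derive_eq psi _ s (0 + / rho s)); [|reflexivity|ring].
    apply (is_derive_plus (fun _ => t0) (fun s => RInt (fun s => / rho s) 0 s)).
    - apply @is_derive_const.
    - exact (is_derive_primitive (fun s => / rho s) 0 s Crho). }
  assert (Hpsi0 : psi 0 = t0).
  { unfold psi. rewrite (@RInt_point R_CompleteNormedModule). apply Rplus_0_r. }
  (* both pairs solve the same linear rotation equation, which preserves their distance *)
  assert (Hdist : forall s, (u s - A * sin (psi s)) ^ 2 + (v s - A * cos (psi s)) ^ 2 = 0).
  { intros s. set (F := fun s => (u s - A * sin (psi s)) ^ 2 + (v s - A * cos (psi s)) ^ 2).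
    assert (DF : forall s, is_derive F s 0).
    { intros x. assert (D1 := is_derive_unique _ _ _ (Du x)).
      assert (D2 := is_derive_unique _ _ _ (Dv x)).
      assert (D3 := is_derive_unique _ _ _ (Dpsi x)).
      unfold F. auto_derive.
      - repeat split; eexists; eauto.
      - replace (Derive (fun x : R => u x) x) with (v x * / rho x) by (symmetry; exact D1).
        replace (Derive (fun x : R => v x) x) with (- (u x * / rho x)) by (symmetry; exact D2).
        replace (Derive (fun x : R => psi x) x) with (/ rho x) by (symmetry; exact D3).
        ring. }
    change (F s = 0). rewrite (zero_derive_constant F DF s 0).
    unfold F. rewrite Hpsi0, Hu0, Hv0. ring. }
  assert (Huv : forall s, u s = A * sin (psi s) /\ v s = A * cos (psi s)).
  { intros s. generalize (Hdist s) (pow2_ge_0 (u s - A * sin (psi s)))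
      (pow2_ge_0 (v s - A * cos (psi s))). intros E E1 E2.
    split; apply Rminus_diag_uniq; apply Rsqr_0_uniq; unfold Rsqr; nra. }
  assert (Hy : forall s, height A (psi s) / h = y s).
  { intros s. unfold height. rewrite <- (proj1 (Huv s)). unfold u. field. lra. }
  assert (Hst : forall s, stretch h A (psi s) = rho s).
  { intros s. unfold stretch, rho. now rewrite Hy. }
  assert (Hra : forall s, radius h A (psi s) = rho s * w s).
  { intros s. assert (Hp := radius_pos h A (psi s) Hh).
    assert (E := radius_stretch_sqr h A (psi s) Hh).
    rewrite Hst, <- (proj2 (Huv s)) in E. unfold v in E.
    apply Rsqr_inj; [lra | apply Rmult_le_pos; apply Rlt_le; auto |].
    unfold Rsqr. transitivity (rho s ^ 2 * w s ^ 2); [|ring].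
    rewrite W2. lra. }
  assert (Hphase : forall s, psi s = phase h A (s + arclength h A t0)).
  { intros s. apply (arclength_injective h A). rewrite arclength_phase.
    assert (D : forall x, is_derive (fun x => arclength h A (psi x) - x) x 0).
    { intros x. apply (is_derive_eq (fun x => arclength h A (psi x) - x) _ x
        (/ rho x * stretch h A (psi x) - 1)).
      - apply (is_derive_minus (fun x => arclength h A (psi x)) (fun x => x)).
        + exact (is_derive_comp (arclength h A) psi x _ _ (is_derive_arclength h A _) (Dpsi x)).
        + apply @is_derive_id.
      - reflexivity.
      - rewrite Hst. field. generalize (Rp x); lra. }
    generalize (zero_derive_constant _ D s 0). rewrite Hpsi0. lra. }
  exists A, (arclength h A t0). split; [exact HA|]. intros s. rewrite <- Hphase.
  assert (Hr := Rp s). assert (Hw := Wp s).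
  split.
  - unfold frame_position. rewrite Hy, Hst, Hra. f_equal.
    + replace (- A * cos (psi s)) with (- v s) by (rewrite (proj2 (Huv s)); ring).
      unfold v. field. lra.
    + rewrite Hnu. field. lra.
  - unfold profile_curvature. rewrite turning_alt, Hy, Hst, Hra by auto.
    apply (Rmult_eq_reg_r (rho s ^ 2 * w s ^ 2)).
    + rewrite HK. field. lra.
    + apply Rgt_not_eq. apply Rmult_lt_0_compat; apply pow_lt; auto.
Qed.

Lemma smooth_cderive (X : R -> C) (s : R) :
  smooth_curve X ->
  has_cderive X s (CDerive X s) /\
  exists a, has_cderive (CDerive X) s a.
Proof.
  intros H. split.
  - destruct (H 1%nat s) as [H1 H2]. split; apply Derive_correct; assumption.
  - destruct (H 2%nat s) as [[a Ha] [b Hb]]. now exists (a, b).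
Qed.

(** Differentiating [|T|^2 = 1] shows that [T'] is orthogonal to [T], hence a real
    multiple of [i T]. *)
Lemma unit_curve_frenet (X : R -> C) (s : R) :
  smooth_curve X -> (forall u, Cmod (CDerive X u) = 1) ->
  exists k, has_cderive (CDerive X) s (RtoC k * (Ci * CDerive X s))%C.
Proof.
  intros HX H1. destruct (smooth_cderive X s HX) as [_ [[a b] Hab]].
  set (T := CDerive X) in *.
  assert (E := unit_dotC _ (H1 s)).
  assert (D := is_derive_dotC T T s _ _ Hab Hab).
  assert (D0 : is_derive (fun u => dotC (T u) (T u)) s 0).
  { apply (is_derive_eq (fun _ => 1) _ _ 0).
    - apply @is_derive_const.
    - intros t. rewrite <- (unit_dotC _ (H1 t)). unfold dotC; ring.
    - reflexivity. }
  assert (O := eq_trans (eq_sym (is_derive_unique _ _ _ D)) (is_derive_unique _ _ _ D0)).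
  exists (Re (T s) * b - Im (T s) * a).
  replace (RtoC (Re (T s) * b - Im (T s) * a) * (Ci * T s))%C with (a, b); [exact Hab|].
  unfold dotC in O. destruct (T s) as [p q].
  unfold Re, Im in *; simpl in *.
  assert (E1 : p * p + q * q = 1) by lra.
  assert (O' : p * a = - (q * b)) by lra.
  unfold Cmult; simpl. f_equal.
  - transitivity (a * (q * q) + p * (p * a)); [transitivity (a * (p * p + q * q))|].
    + rewrite E1; ring.
    + ring.
    + rewrite O'. ring.
  - transitivity (b * (p * p) - q * (- (q * b))); [transitivity (b * (p * p + q * q))|].
    + rewrite E1; ring.
    + ring.
    + rewrite <- O'. ring.
Qed.

(** Once the frame coordinates agree with those of a model curve, so do the curvatures,
    and the quotient of the two unit tangents is a constant rotation. *)
Lemma CMC_curve_classification (h : R) (Y : R -> C) :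
  0 < h -> smooth_curve Y -> (forall s, Cmod (CDerive Y s) = 1) ->
  generates_CMC h 1 Y ->
  exists (A c : R) (z : C), 0 <= A /\ Cmod z = 1 /\
    forall s, Y s = (z * profile h A (s + c)%R)%C.
Proof.
  intros Hh HY H1 HC. set (T := CDerive Y).
  assert (DY : forall s, has_cderive Y s (T s)) by (intros; apply smooth_cderive, HY).
  set (tau := fun s => dotC (Y s) (T s)). set (nu := fun s => dotC (Y s) (Ci * T s)%C).
  set (k := fun s => Re (CDerive T s) * Re (Ci * T s)%C + Im (CDerive T s) * Im (Ci * T s)%C).
  assert (DT : forall s, has_cderive T s (RtoC (k s) * (Ci * T s))%C).
  { intros s. destruct (unit_curve_frenet Y s HY H1) as [a Ha]. fold T in Ha.
    replace (k s) with a; [exact Ha|].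
    unfold k. rewrite (CDerive_unique _ _ _ Ha).
    transitivity (a * (Re (T s) ^ 2 + Im (T s) ^ 2)).
    - unfold T. rewrite (unit_dotC _ (H1 s)). ring.
    - unfold Re, Im; simpl. ring. }
  destruct (frame_system_solutions h tau nu k Hh) as [A [c [HA Hsol]]].
  - intros s. apply is_derive_tau; auto.
  - intros s.
    assert (D := is_derive_dotC Y (fun u => Ci * T u)%C s _ _ (DY s)
      (has_cderive_mult _ _ _ _ _ (has_cderive_const Ci s) (DT s))).
    apply (is_derive_eq _ _ _ _ _ D); [reflexivity|].
    unfold tau, dotC, Re, Im; simpl. ring.
  - intros s. assert (E := HC s 0).
    rewrite (helicoidal_mean_curvature h Y T (k s)) in E; auto.
    fold (tau s) (nu s) in E.
    assert (Hp : 0 < sqrt (tau s ^ 2 + h ^ 2) ^ 3).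
    { apply pow_lt, sqrt_lt_R0. generalize (pow2_ge_0 (tau s)); nra. }
    apply (f_equal (fun x => x * sqrt (tau s ^ 2 + h ^ 2) ^ 3)) in E.
    rewrite Rmult_1_l in E. rewrite <- E. field. apply Rgt_not_eq.
    apply sqrt_lt_R0. generalize (pow2_ge_0 (tau s)); nra.
  - set (th := fun s => tangent_angle h A (phase h A (s + c))).
    assert (Dth : forall s, is_derive (fun s => - th s) s (- k s)).
    { intros s. rewrite (proj2 (Hsol s)). apply (is_derive_opp th).
      assert (D : is_derive (fun u : R => u + c) s 1) by (auto_derive; auto; ring).
      apply (is_derive_eq _ _ _ _ _ (is_derive_comp
        (fun s => tangent_angle h A (phase h A s)) (fun u => u + c) s _ _
        (is_derive_profile_angle h A (s + c) Hh) D)); [reflexivity|].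
      unfold scal; simpl; unfold mult; simpl. ring. }
    assert (Hconst : forall s, (T s * cis (- th s))%C = (T 0 * cis (- th 0))%C).
    { intros s. apply (zero_cderive_constant (fun s => T s * cis (- th s))%C).
      intros x.
      assert (D := has_cderive_mult _ _ _ _ _ (DT x) (has_cderive_cis _ _ _ (Dth x))).
      cbv beta in D.
      replace (RtoC 0) with (k x * (Ci * T x) * cis (- th x)
        + T x * ((- k x)%R * (Ci * cis (- th x))))%C; [exact D|].
      rewrite RtoC_opp. ring. }
    exists A, c, (T 0 * cis (- th 0))%C.
    split; [exact HA|]. split.
    + rewrite Cmod_mult, Cmod_cis. unfold T. rewrite H1. ring.
    + intros s.
      assert (HT : T s = (T 0 * cis (- th 0) * profile_tangent h A (s + c)%R)%C).
      { rewrite <- (Hconst s). unfold profile_tangent. fold (th s).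
        rewrite <- Cmult_assoc, <- cis_plus, Rplus_opp_l, cis_0. ring. }
      unfold profile. fold (profile_tangent h A (s + c)).
      rewrite Cmult_assoc, <- HT, <- (proj1 (Hsol s)).
      unfold tau, nu. assert (E := unit_dotC _ (H1 s)). fold T in E.
      destruct (Y s) as [a b], (T s) as [p q].
      unfold dotC, Re, Im in *; simpl in *. unfold Cmult; simpl.
      assert (E1 : p * p + q * q = 1) by lra. f_equal.
      * transitivity (a * (p * p + q * q)); [rewrite E1|]; ring.
      * transitivity (b * (p * p + q * q)); [rewrite E1|]; ring.
Qed.

(** * Winding around the origin *)

Definition angle_near (z : R -> C) (a : R -> R) (s : R) : R :=
  a s + atan (dotC (z s) (Ci * cis (a s))%C / dotC (z s) (cis (a s))).

Lemma continuous_angle_near (z : R -> C) (a : R -> R) (s : R) :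
  continuous (fun u => Re (z u)) s -> continuous (fun u => Im (z u)) s ->
  continuous a s -> 0 < dotC (z s) (cis (a s)) ->
  continuous (angle_near z a) s.
Proof.
  intros C1 C2 Ca Hd.
  assert (Cc : continuous (fun u => cos (a u)) s)
    by (apply (continuous_comp a cos); [exact Ca | apply continuous_cos]).
  assert (Cs : continuous (fun u => sin (a u)) s)
    by (apply (continuous_comp a sin); [exact Ca | apply continuous_sin]).
  apply (continuous_plus a (fun u => atan (dotC (z u) (Ci * cis (a u))%C
    / dotC (z u) (cis (a u)))) s Ca).
  apply (continuous_comp (fun u => dotC (z u) (Ci * cis (a u))%C
    / dotC (z u) (cis (a u))) atan).
  2:{ apply continuity_pt_filterlim, derivable_continuous_pt, derivable_pt_atan. }
  apply (continuous_mult (fun u => dotC (z u) (Ci * cis (a u))%C)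
    (fun u => / dotC (z u) (cis (a u)))).
  - apply (continuous_ext (fun u => Im (z u) * cos (a u) - Re (z u) * sin (a u))).
    { intros u. unfold dotC, Re, Im; simpl. ring. }
    apply (continuous_minus (fun u => Im (z u) * cos (a u)) (fun u => Re (z u) * sin (a u)) s);
      [apply (continuous_mult (fun u => Im (z u)) (fun u => cos (a u)))
      |apply (continuous_mult (fun u => Re (z u)) (fun u => sin (a u)))]; assumption.
  - apply (continuous_comp (fun u => dotC (z u) (cis (a u))) Rinv).
    + apply (continuous_plus (fun u => Re (z u) * cos (a u)) (fun u => Im (z u) * sin (a u)) s);
      [apply (continuous_mult (fun u => Re (z u)) (fun u => cos (a u)))
      |apply (continuous_mult (fun u => Im (z u)) (fun u => sin (a u)))]; assumption.
    + apply continuous_Rinv. lra.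
Qed.

Lemma continuous_phase (h A s : R) : continuous (phase h A) s.
Proof. exact (continuous_of_is_derive _ _ _ (is_derive_phase h A s)). Qed.

Lemma continuous_profile_angle (h A s : R) :
  0 < h -> continuous (fun s => tangent_angle h A (phase h A s)) s.
Proof. intros Hh. exact (continuous_of_is_derive _ _ _ (is_derive_profile_angle h A s Hh)). Qed.

Lemma profile_angle_increment (h A s : R) (k : Z) :
  0 < h ->
  tangent_angle h A (phase h A (s + IZR k * period_length h A))
  = tangent_angle h A (phase h A s) + IZR k * total_turning h A.
Proof. intros Hh. now rewrite phase_period, tangent_angle_period. Qed.

Lemma CDerive_profile (h A : R) : 0 < h -> CDerive (profile h A) = profile_tangent h A.
Proof.
  intros Hh. apply functional_extensionality. intros s.
  apply CDerive_unique, has_cderive_profile, Hh.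
Qed.

Lemma profile_rotation_number (h A : R) (q p : Z) :
  0 < h -> IZR q * total_turning h A = 2 * PI * IZR p ->
  rotation_number (profile h A) (IZR q * period_length h A) p.
Proof.
  intros Hh Hq. unfold rotation_number. rewrite CDerive_profile by auto. split.
  - intros s. apply cis_neq_0.
  - exists (fun s => tangent_angle h A (phase h A s)). split; [|split].
    + intros s. apply continuous_profile_angle, Hh.
    + intros s. rewrite Cmod_profile_tangent. unfold profile_tangent. ring.
    + rewrite <- Hq, <- (Rplus_0_l (IZR q * period_length h A)).
      rewrite profile_angle_increment by auto. ring.
Qed.

(** The polar angle of the curve is the sum of the tangent angle, which gives [p] turns,
    and of the polar angle [beta] of the frame coordinates. *)
Lemma profile_winding_number (h A : R) (beta : R -> R) (q p n : Z) :
  0 < h -> IZR q * total_turning h A = 2 * PI * IZR p ->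
  (forall x, continuous beta x) ->
  (forall x, exists m, 0 < m /\ frame_position h A x = (RtoC m * cis (beta x))%C) ->
  (forall x, beta (x + IZR q * (2 * PI)) = beta x + 2 * PI * IZR n) ->
  winding_number (profile h A) (IZR q * period_length h A) (p + n).
Proof.
  intros Hh Hq Hc Hb Hp.
  assert (HX : forall s, exists m, 0 < m /\ profile h A s
    = (RtoC m * cis (tangent_angle h A (phase h A s) + beta (phase h A s))%R)%C).
  { intros s. destruct (Hb (phase h A s)) as [m [Hm E]]. exists m. split; auto.
    unfold profile. rewrite E, cis_plus. ring. }
  split.
  - intros s. destruct (HX s) as [m [Hm ->]]. apply Cmult_neq_0; [|apply cis_neq_0].
    intros E. injection E; lra.
  - exists (fun s => tangent_angle h A (phase h A s) + beta (phase h A s)).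
    split; [|split].
    + intros s. apply @continuous_plus; [apply continuous_profile_angle, Hh|].
      apply (continuous_comp (phase h A) beta); [apply continuous_phase | apply Hc].
    + intros s. destruct (HX s) as [m [Hm E]].
      apply (polar_form_scale _ m); [lra | exact E].
    + rewrite <- (Rplus_0_l (IZR q * period_length h A)).
      rewrite profile_angle_increment, phase_period, Hp, plus_IZR by auto.
      rewrite Hq. ring.
Qed.

Lemma continuous_frame_position (h A x : R) :
  0 < h -> continuous (fun u => Re (frame_position h A u)) x /\
    continuous (fun u => Im (frame_position h A u)) x.
Proof.
  intros Hh. destruct (is_derive_frame_position h A x Hh) as [D1 D2].
  split; [exact (continuous_of_is_derive _ _ _ D1) | exact (continuous_of_is_derive _ _ _ D2)].
Qed.

(** Here [height] is negative, so the frame coordinates stay in the lower half plane. *)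
Lemma winding_number_small (h A : R) (q p : Z) :
  0 < h -> 0 < A < 1 -> IZR q * total_turning h A = 2 * PI * IZR p ->
  winding_number (profile h A) (IZR q * period_length h A) p.
Proof.
  intros Hh HA Hq. rewrite <- (Z.add_0_r p).
  set (a := (fun _ => - PI / 2) : R -> R).
  assert (Hd : forall x, 0 < dotC (frame_position h A x) (cis (a x))).
  { intros x. unfold a, cis, dotC. rewrite cos_left_end, sin_left_end. simpl.
    assert (Hp := radius_pos h A x Hh). assert (Hs := stretch_ge_1 h A x).
    assert (Hb := SIN_bound x).
    assert (0 < radius h A x / (h * stretch h A x)).
    { apply Rdiv_lt_0_compat; auto. apply Rmult_lt_0_compat; lra. }
    assert (height A x < 0) by (unfold height; nra).
    replace (- A * cos x / stretch h A x * 0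
       + height A x / h * radius h A x / stretch h A x * -1)
      with (- height A x * (radius h A x / (h * stretch h A x))) by (field; lra).
    apply Rmult_lt_0_compat; lra. }
  apply (profile_winding_number h A (angle_near (frame_position h A) a)); auto.
  - intros x. destruct (continuous_frame_position h A x Hh).
    apply continuous_angle_near; auto. apply continuous_const.
  - intros x. apply polar_form_near, Hd.
  - intros x. unfold angle_near. rewrite frame_position_periodic. unfold a. simpl. ring.
Qed.

(** The frame coordinates arise from [w = (- A cos x, A sin x - 1)] by multiplying the
    two components with positive factors, so they stay within a right angle of [w].
    In turn [w = - cis (- x) * (A + i cis x)] stays within a right angle of
    [cis (PI - x)] when [1 < A], and this direction turns once in the negative
    sense. *)
Lemma winding_number_large (h A : R) (q p : Z) :
  0 < h -> 1 < A -> IZR q * total_turning h A = 2 * PI * IZR p ->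
  winding_number (profile h A) (IZR q * period_length h A) (p - q).
Proof.
  intros Hh HA Hq. change (p - q)%Z with (p + - q)%Z.
  set (w := fun x => (- A * cos x, height A x) : C).
  set (a := fun x => PI - x).
  assert (Hw : forall x, 0 < dotC (w x) (cis (a x))).
  { intros x. unfold w, a, height, cis, dotC; simpl.
    rewrite cos_minus, sin_minus, cos_PI, sin_PI.
    assert (Hb := SIN_bound x). assert (E := sin2_cos2 x). unfold Rsqr in E.
    replace (- A * cos x * (-1 * cos x + 0 * sin x)
      + (A * sin x - 1) * (0 * cos x - -1 * sin x))
      with (A * (sin x * sin x + cos x * cos x) - sin x) by ring.
    rewrite E. lra. }
  set (b := angle_near w a).
  assert (Hfb : forall x, 0 < dotC (frame_position h A x) (cis (b x))).
  { intros x. destruct (polar_form_near (w x) (a x) (Hw x)) as [m [Hm E]].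
    change (w x = (RtoC m * cis (b x))%C) in E.
    assert (H : 0 < dotC (frame_position h A x) (w x)).
    { unfold w, frame_position, dotC; simpl.
      assert (Hp := radius_pos h A x Hh). assert (Hs := stretch_ge_1 h A x).
      replace (- A * cos x / stretch h A x * (- A * cos x)
         + height A x / h * radius h A x / stretch h A x * height A x)
        with (((A * cos x) ^ 2 + radius h A x / h * height A x ^ 2) / stretch h A x)
        by (field; lra).
      apply Rdiv_lt_0_compat; [|lra].
      assert (Hrh : 0 < radius h A x / h) by (apply Rdiv_lt_0_compat; lra).
      destruct (Req_dec (height A x) 0) as [Z|Z].
      - unfold height in Z. assert (E1 := cos2_sin2 x).
        assert (0 < (A * cos x) ^ 2).
        { rewrite Rpow_mult_distr, E1.
          replace (A ^ 2 * (1 - sin x ^ 2)) with (A ^ 2 - (A * sin x) ^ 2) by ring.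
          replace (A * sin x) with 1 by lra. nra. }
        assert (Hh2 := pow2_ge_0 (height A x)). nra.
      - assert (0 < height A x ^ 2) by (apply pow2_gt_0; auto).
        assert (Hc2 := pow2_ge_0 (A * cos x)). nra. }
    rewrite E in H.
    replace (dotC (frame_position h A x) (RtoC m * cis (b x))%C)
      with (m * dotC (frame_position h A x) (cis (b x))) in H
      by (unfold dotC, Re, Im; simpl; ring).
    nra. }
  assert (Ca : forall x, continuous a x).
  { intros x. apply @ex_derive_continuous. unfold a. auto_derive. auto. }
  assert (Cb : forall x, continuous b x).
  { intros x. apply continuous_angle_near; auto.
    - apply @ex_derive_continuous. unfold w; simpl. auto_derive. auto.
    - apply continuous_height. }
  apply (profile_winding_number h A (angle_near (frame_position h A) b)); auto.
  - intros x. destruct (continuous_frame_position h A x Hh).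
    apply continuous_angle_near; auto.
  - intros x. apply polar_form_near, Hfb.
  - intros x.
    assert (Hper : forall y, cis (y + 2 * PI * IZR (- q)) = cis y)
      by (intros; apply cis_period).
    assert (Hx : cis (x + IZR q * (2 * PI)) = cis x).
    { rewrite <- (cis_period x q). f_equal. ring. }
    assert (Ha : a (x + IZR q * (2 * PI)) = a x + 2 * PI * IZR (- q)).
    { unfold a. rewrite opp_IZR. ring. }
    assert (Hwx : w (x + IZR q * (2 * PI)) = w x).
    { injection Hx as E1 E2. unfold w, height. now rewrite E1, E2. }
    assert (Hb : b (x + IZR q * (2 * PI)) = b x + 2 * PI * IZR (- q)).
    { unfold b, angle_near. rewrite Hwx, Ha, Hper. ring. }
    unfold angle_near at 1. rewrite frame_position_periodic, Hb, Hper.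
    unfold angle_near. ring.
Qed.

Lemma profile_through_origin (h : R) : exists s, profile h 1 s = RtoC 0.
Proof.
  exists (arclength h 1 (PI / 2)). unfold profile. rewrite phase_arclength.
  replace (frame_position h 1 (PI / 2)) with (RtoC 0); [ring|].
  unfold frame_position, height. rewrite cos_PI2, sin_PI2.
  unfold Rdiv, RtoC. f_equal; ring.
Qed.

(** * Closed curves *)

(** The rotation by [2 PI p / q] has order [q] because [p] and [q] are coprime. *)
Lemma turning_multiple_trivial (Th : R) (p q : nat) (j : Z) :
  (0 < q)%nat -> Nat.gcd p q = 1%nat -> INR q * Th = 2 * PI * INR p ->
  cis (IZR j * Th) = RtoC 1 -> (Z.of_nat q | j)%Z.
Proof.
  intros Hq Hg HT H. destruct (cis_eq_1 _ H) as [m Hm].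
  assert (Hpi := PI_RGT_0).
  assert (E : (j * Z.of_nat p = Z.of_nat q * m)%Z).
  { apply eq_IZR. rewrite !mult_IZR, <- !INR_IZR_INZ.
    apply (Rmult_eq_reg_l (2 * PI)); [|lra].
    transitivity (IZR j * (2 * PI * INR p)); [ring|].
    rewrite <- HT.
    transitivity (INR q * (IZR j * Th)); [ring|]. rewrite Hm. ring. }
  assert (N : Nat.divide q (Z.abs_nat j)).
  { apply (Nat.gauss q p).
    - exists (Z.abs_nat m).
      rewrite <- (Zabs2Nat.id p), <- (Zabs2Nat.id q), <- !Zabs2Nat.inj_mul.
      rewrite (Z.mul_comm _ j), E. f_equal. ring.
    - now rewrite Nat.gcd_comm. }
  destruct N as [r Hr]. apply Z.divide_abs_r. exists (Z.of_nat r).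
  rewrite <- Zabs2Nat.id_abs, Hr. apply Nat2Z.inj_mul.
Qed.

Lemma profile_rotation_preserves (h A : R) (k : Z) :
  0 < h -> rotation_preserves (cis (IZR k * total_turning h A)) (profile h A).
Proof.
  intros Hh. split; [apply Cmod_cis|]. exists (IZR k * period_length h A).
  intros s. now rewrite profile_period.
Qed.

Lemma profile_admissible (h A : R) (p q : nat) :
  0 < h -> 0 < A -> (0 < q)%nat -> Nat.gcd p q = 1%nat ->
  INR q * total_turning h A = 2 * PI * INR p ->
  admissible h p q (profile h A) (INR q * period_length h A).
Proof.
  intros Hh HA Hq Hg HT.
  assert (Hq0 : 0 < INR q) by (apply lt_0_INR; auto).
  assert (HS := period_length_pos h A).
  assert (HT' : IZR (Z.of_nat q) * total_turning h A = 2 * PI * IZR (Z.of_nat p))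
    by (now rewrite <- !INR_IZR_INZ).
  assert (triv := fun j => turning_multiple_trivial _ p q j Hq Hg HT).
  split; [split; [|split; [|split; [|split]]] | split; [|split]].
  - apply profile_smooth, Hh.
  - intros s. rewrite CDerive_profile by auto. apply Cmod_profile_tangent.
  - apply Rmult_lt_0_compat; auto.
  - intros s. rewrite (INR_IZR_INZ q), profile_period, HT' by auto.
    replace (2 * PI * IZR (Z.of_nat p)) with (0 + 2 * PI * IZR (Z.of_nat p)) by ring.
    rewrite cis_period, cis_0. ring.
  - intros P HP Hper.
    destruct (profile_symmetries h A P (RtoC 1) Hh HA) as [k [Hk1 Hk2]].
    + apply Cmod_1.
    + intros s. rewrite Hper. ring.
    + assert (Hdiv := triv k (eq_sym Hk2)).
      assert (Hk0 : 0 < IZR k < INR q).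
      { rewrite Hk1 in HP. destruct HP as [HP1 HP2]. split.
        - apply (Rmult_lt_reg_r (period_length h A)); lra.
        - apply (Rmult_lt_reg_r (period_length h A)); lra. }
      rewrite INR_IZR_INZ in Hk0. destruct Hk0 as [K1 K2].
      apply lt_IZR in K1. apply lt_IZR in K2.
      apply (Z.divide_pos_le _ _ K1) in Hdiv. lia.
  - rewrite INR_IZR_INZ. apply profile_rotation_number; auto.
  - exists (cis (total_turning h A)). split; [|split].
    + intros z. split.
      * intros [Hz [c Hc]].
        destruct (profile_symmetries h A c z Hh HA Hz Hc) as [j [_ ->]].
        exists (Z.to_nat (j mod Z.of_nat q)).
        assert (B := Z.mod_pos_bound j (Z.of_nat q) ltac:(lia)).
        rewrite cis_pow, INR_IZR_INZ, Z2Nat.id by lia.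
        rewrite <- (cis_period (IZR (j mod Z.of_nat q) * total_turning h A)
          (Z.of_nat p * (j / Z.of_nat q))).
        f_equal. rewrite mult_IZR.
        assert (Ej : IZR j = IZR (Z.of_nat q) * IZR (j / Z.of_nat q) + IZR (j mod Z.of_nat q)).
        { rewrite <- mult_IZR, <- plus_IZR. f_equal. apply Z.div_mod. lia. }
        rewrite Ej.
        transitivity (IZR (j mod Z.of_nat q) * total_turning h A
          + 2 * PI * IZR (Z.of_nat p) * IZR (j / Z.of_nat q)); [|ring].
        rewrite <- HT'. ring.
      * intros [k ->]. rewrite cis_pow, INR_IZR_INZ.
        apply profile_rotation_preserves, Hh.
    + rewrite cis_pow, HT, INR_IZR_INZ.
      replace (2 * PI * IZR (Z.of_nat p)) with (0 + 2 * PI * IZR (Z.of_nat p)) by ring.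
      now rewrite cis_period, cis_0.
    + intros k Hk E. rewrite cis_pow, INR_IZR_INZ in E.
      assert (Hdiv := triv _ E). apply Z.divide_pos_le in Hdiv; lia.
  - apply profile_generates_CMC, Hh.
Qed.

Lemma rotation_preserves_moved (X Y : R -> C) (z w : C) (c : R) :
  Cmod z = 1 -> (forall s, Y s = (z * X (s + c)%R)%C) ->
  rotation_preserves w Y <-> rotation_preserves w X.
Proof.
  intros Hz HY. unfold rotation_preserves. split; intros [Hw [d Hd]]; split; auto; exists d.
  - intros s. apply (cancel_unit z _ _ Hz).
    assert (E := Hd (s - c)). rewrite !HY in E.
    replace (s - c + c) with s in E by ring.
    replace (s - c + d + c) with (s + d) in E by ring.
    rewrite <- E. ring.
  - intros s. rewrite !HY. replace (s + d + c) with (s + c + d) by ring.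
    rewrite <- Hd. ring.
Qed.

(** For [A = 0] the frame coordinates and the curvature are constant, so that a
    translation of the parameter acts as a rotation. A finite rotation group thus
    excludes [A = 0]. *)
Lemma circle_rotation_preserves (h : R) (z : C) :
  0 < h -> Cmod z = 1 -> rotation_preserves z (profile h 0).
Proof.
  intros Hh Hz. split; auto. destruct (unit_cis z Hz) as [b ->].
  assert (Hcst : forall x y, frame_position h 0 x = frame_position h 0 y).
  { intros x y. unfold frame_position, stretch, radius, height.
    now rewrite !Rmult_0_r, !Rmult_0_l, Ropp_0, !Rmult_0_l. }
  assert (Hk : forall s, profile_curvature h 0 (phase h 0 s) = profile_curvature h 0 0).
  { intros s. unfold profile_curvature, turning, stretch, radius, height.
    now rewrite !Rmult_0_r, !Rmult_0_l. }
  set (k := profile_curvature h 0 0) in *.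
  assert (Hk0 : 0 < k).
  { unfold k, profile_curvature. rewrite turning_alt by auto.
    assert (Hp := radius_pos h 0 0 Hh). assert (Hs := stretch_ge_1 h 0 0).
    unfold height. rewrite Rmult_0_l.
    replace (radius h 0 0 / (h * stretch h 0 0 ^ 2) - (0 - 1) / h / radius h 0 0)
      with (radius h 0 0 / (h * stretch h 0 0 ^ 2) + / (h * radius h 0 0)) by (field; lra).
    apply Rdiv_lt_0_compat; [|lra].
    apply Rplus_lt_0_compat; [|apply Rinv_0_lt_compat, Rmult_lt_0_compat; lra].
    apply Rdiv_lt_0_compat; auto. apply Rmult_lt_0_compat; auto. apply pow_lt; lra. }
  assert (Hlin : forall s, tangent_angle h 0 (phase h 0 s)
    = tangent_angle h 0 (phase h 0 0) + k * s).
  { intros s.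
    assert (D : forall x, is_derive (fun x => tangent_angle h 0 (phase h 0 x) - k * x) x 0).
    { intros x. apply (is_derive_eq (fun x => tangent_angle h 0 (phase h 0 x) - k * x) _ x
        (profile_curvature h 0 (phase h 0 x) - k)).
      - apply (is_derive_minus (fun x => tangent_angle h 0 (phase h 0 x)) (fun x => k * x)).
        + apply is_derive_profile_angle, Hh.
        + auto_derive; auto; ring.
      - reflexivity.
      - rewrite Hk. ring. }
    generalize (zero_derive_constant _ D s 0). lra. }
  exists (b / k). intros s. unfold profile.
  rewrite (Hcst (phase h 0 (s + b / k)) (phase h 0 s)), (Hlin s), (Hlin (s + b / k)).
  rewrite Cmult_assoc, <- cis_plus. do 2 f_equal. field. lra.
Qed.

(** The number of phase periods in the length of an admissible curve equals the order
    of its rotation group; the rotation number then fixes the turning per period. *)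
Lemma admissible_classification (h : R) (p q : nat) (Y : R -> C) (L : R) :
  0 < h -> (0 < q)%nat -> admissible h p q Y L ->
  exists (A c : R) (z : C), 0 < A /\ Cmod z = 1 /\
    (forall s, Y s = (z * profile h A (s + c)%R)%C) /\
    INR q * total_turning h A = 2 * PI * INR p.
Proof.
  intros Hh Hq [[HY [H1 [HL [Hper Hmin]]]] [[_ [phi [Cphi [Ephi Iphi]]]] [[g [Hg1 [Hg2 Hg3]]] HC]]].
  destruct (CMC_curve_classification h Y Hh HY H1 HC) as [A [c [z [HA [Hz HYX]]]]].
  assert (Hpres := fun w => rotation_preserves_moved (profile h A) Y z w c Hz HYX).
  assert (Hq0 : 0 < INR q) by (apply lt_0_INR; auto).
  destruct (Req_dec A 0) as [HA0|HA0].
  { exfalso. subst A.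
    destruct (proj1 (Hg1 (cis (PI / INR q)))) as [k Hk].
    { apply Hpres, circle_rotation_preserves; auto. apply Cmod_cis. }
    assert (E : (cis (PI / INR q) ^ q)%C = RtoC 1).
    { now rewrite Hk, <- Cpow_mult_r, Nat.mul_comm, Cpow_mult_r, Hg2, Cpow_1_l. }
    rewrite cis_pow in E. replace (INR q * (PI / INR q)) with PI in E by (field; lra).
    injection E. rewrite cos_PI. lra. }
  assert (HAp : 0 < A) by lra.
  exists A, c, z. do 3 (split; [assumption|]).
  set (Th := total_turning h A). set (S := period_length h A).
  assert (HS : 0 < S) by apply period_length_pos.
  (* the length of the curve is a whole number [j] of phase periods *)
  destruct (profile_symmetries h A L (RtoC 1) Hh HAp Cmod_1) as [j [Hj1 Hj2]].
  { intros s. apply (cancel_unit z _ _ Hz).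
    assert (E := Hper (s - c)). rewrite !HYX in E.
    replace (s - c + L + c) with (s + L) in E by ring.
    replace (s - c + c) with s in E by ring. rewrite E. ring. }
  fold S in Hj1. fold Th in Hj2.
  assert (Hj0 : (0 < j)%Z).
  { apply lt_IZR. apply (Rmult_lt_reg_r S); lra. }
  assert (HjT : IZR j * Th = 2 * PI * INR p).
  { destruct (unit_cis z Hz) as [b Hb].
    assert (E := angle_lift_unique phi
      (fun s => b + tangent_angle h A (phase h A (s + c))) Cphi).
    rewrite INR_IZR_INZ, <- Iphi, E.
    - rewrite Rplus_0_l, (Rplus_comm L c), Hj1. unfold S, Th.
      rewrite profile_angle_increment by auto. ring.
    - intros s. apply (continuous_plus (fun _ => b)); [apply continuous_const|].
      apply (continuous_comp (fun s => s + c) (fun s => tangent_angle h A (phase h A s))).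
      + apply (continuous_plus (fun s => s) (fun _ => c)).
        * apply continuous_id.
        * apply continuous_const.
      + apply continuous_profile_angle, Hh.
    - intros s. assert (Es := Ephi s). rewrite H1, Cmult_1_l in Es. rewrite <- Es.
      rewrite cis_plus, <- Hb. apply CDerive_unique.
      apply (CDerive_rotate_shift z (profile h A) Y c s); auto.
      apply has_cderive_profile, Hh. }
  assert (Hqj : (Z.of_nat q = j)%Z).
  { apply Z.le_antisymm.
    (* the generator has order at most [j] *)
    - destruct (proj1 (Hpres g)) as [Hgm [d Hd]].
      { apply Hg1. exists 1%nat. simpl. ring. }
      destruct (profile_symmetries h A d g Hh HAp Hgm Hd) as [i [_ Hi]].
      assert (E : (g ^ Z.to_nat j)%C = RtoC 1).
      { rewrite Hi, cis_pow, INR_IZR_INZ, Z2Nat.id by lia. fold Th.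
        replace (IZR j * (IZR i * Th)) with (0 + 2 * PI * IZR (Z.of_nat p * i)).
        - now rewrite cis_period, cis_0.
        - rewrite mult_IZR, <- INR_IZR_INZ.
          transitivity (IZR i * (2 * PI * INR p)); [ring|]. rewrite <- HjT. ring. }
      destruct (Z.le_gt_cases (Z.of_nat q) j) as [|Hlt]; auto.
      exfalso. apply (Hg3 (Z.to_nat j)); [lia | exact E].
    (* [q] phase periods close the curve up *)
    - destruct (proj1 (Hg1 (cis Th))) as [k Hk].
      { apply Hpres. replace Th with (IZR 1 * total_turning h A) by (unfold Th; ring).
        apply profile_rotation_preserves, Hh. }
      assert (E : cis (INR q * Th) = RtoC 1).
      { now rewrite <- cis_pow, Hk, <- Cpow_mult_r, Nat.mul_comm, Cpow_mult_r, Hg2, Cpow_1_l. }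
      destruct (Z.le_gt_cases j (Z.of_nat q)) as [|Hlt]; auto.
      exfalso. apply (Hmin (INR q * S)).
      + split; [apply Rmult_lt_0_compat; auto|].
        rewrite Hj1, INR_IZR_INZ. apply Rmult_lt_compat_r; auto. now apply IZR_lt.
      + intros s. rewrite !HYX. replace (s + INR q * S + c) with (s + c + INR q * S) by ring.
        unfold S. rewrite INR_IZR_INZ, profile_period by auto.
        rewrite <- INR_IZR_INZ. fold Th. rewrite E. ring. }
  now rewrite INR_IZR_INZ, Hqj.
Qed.

Lemma total_turning_lt_inv (h A B : R) :
  0 < h -> 0 <= A -> 0 <= B -> total_turning h B < total_turning h A -> A < B.
Proof.
  intros Hh HA HB H. destruct (Rtotal_order A B) as [L|[E|L]]; auto.
  - subst. lra.
  - generalize (total_turning_decreasing h B A Hh ltac:(lra)). lra.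
Qed.

Lemma total_turning_injective (h A B : R) :
  0 < h -> 0 <= A -> 0 <= B -> total_turning h A = total_turning h B -> A = B.
Proof.
  intros Hh HA HB H. destruct (Rtotal_order A B) as [L|[E|L]]; auto.
  - generalize (total_turning_decreasing h A B Hh ltac:(lra)). lra.
  - generalize (total_turning_decreasing h B A Hh ltac:(lra)). lra.
Qed.

Theorem theorem6p5 (h : R) (p q : nat)
  (hh : 0 < h) (hp : (0 < p)%nat) (hq : (0 < q)%nat)
  (hpq : Nat.gcd p q = 1%nat)
  (hlow : 1 < INR p / INR q)
  (hupp : INR p / INR q < sqrt (h ^ 2 + 1) / h) :
  exists (X : R -> C) (L : R),
    admissible h p q X L /\
    (forall (Y : R -> C) (L' : R), admissible h p q Y L' -> rotated_copy X Y) /\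
    (INR p / INR q = alpha h -> exists s, X s = RtoC 0) /\
    (INR p / INR q > alpha h -> winding_number X L (Z.of_nat p)) /\
    (INR p / INR q < alpha h ->
       winding_number X L (Z.of_nat p - Z.of_nat q)%Z).
Proof.
  assert (Hq0 : 0 < INR q) by (apply lt_0_INR; auto).
  assert (Hpi := PI_RGT_0).
  destruct (total_turning_surjective h (INR p / INR q) hh (conj hlow hupp)) as [A [HA HT]].
  assert (HqT : INR q * total_turning h A = 2 * PI * INR p).
  { rewrite HT. field. lra. }
  assert (Hcrit := total_turning_critical h hh).
  assert (HqZ : IZR (Z.of_nat q) * total_turning h A = 2 * PI * IZR (Z.of_nat p))
    by (now rewrite <- !INR_IZR_INZ).
  exists (profile h A), (INR q * period_length h A).
  split; [|split; [|split; [|split]]].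
  - apply profile_admissible; auto.
  - intros Y L' HY.
    destruct (admissible_classification h p q Y L' hh hq HY) as [B [c [z [HB [Hz [HYX HB2]]]]]].
    assert (E : B = A).
    { apply (total_turning_injective h); try lra.
      apply (Rmult_eq_reg_l (INR q)); lra. }
    subst B. exists z. split; [exact Hz|]. exists (- c). intros s.
    rewrite HYX. do 2 f_equal. ring.
  - intros E. assert (EA : A = 1).
    { apply (total_turning_injective h); try lra. rewrite HT, Hcrit, E. reflexivity. }
    rewrite EA. apply profile_through_origin.
  - intros E. rewrite INR_IZR_INZ. apply winding_number_small; auto. split; auto.
    apply (total_turning_lt_inv h); try lra. rewrite HT, Hcrit.
    apply Rmult_lt_compat_l; lra.
  - intros E. rewrite INR_IZR_INZ. apply winding_number_large; auto.
    apply (total_turning_lt_inv h); try lra. rewrite HT, Hcrit.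
    apply Rmult_lt_compat_l; lra.
Qed.
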